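(* Let $\Gamma=\Gamma(S_{d_0},HF)$ be a finitely generated saturated directed group acting on $T_{\bar d}$ with $\bar d$ bounded and $F$ a nontrivial finite group, and let $\mu$ be the step law described below. Then for every $\varepsilon>0$ and all $n$ large enough, $$\left|\frac{\log H_{\Gamma,\mu}(n)}{\log n}-\beta(n)\right|\le\varepsilon.$$ In particular $\limsup_n\frac{\log H_{\Gamma,\mu}(n)}{\log n}=\limsup_n\beta(n)$ and $\liminf_n\frac{\log H_{\Gamma,\mu}(n)}{\log n}=\liminf_n\beta(n)$.
   Context: $\bar d=(d_j)_{j\ge0}$ is a bounded sequence of integers $d_j\ge2$, $\sigma\bar d=(d_1,d_2,\dots)$. $T_{\bar d}$ is the spherically homogeneous rooted tree with vertices the finite sequences $i_1\dots i_k$, $i_j\in\{1,\dots,d_{j-1}\}$; $\partial T_{\bar d}$ its boundary; $1^\infty=111\dots$. Products of automorphisms follow $(gf)(x)=f(g(x))$. Each $g\in\mathrm{Aut}(T_{\bar d})$ is written $g=(g_1,\dots,g_{d_0})\tau$ ($g_t\in\mathrm{Aut}(T_{\sigma\bar d})$, $\tau\in S_{d_0}$, $g(ty)=\tau(t)g_t(y)$); rooted automorphisms ($g_t=1$ for all $t$) form a copy of $S_{d_0}$. $H_{\bar d}$ is defined recursively: $h\in H_{\bar d}$ iff $h=(h',\sigma_2,\dots,\sigma_{d_0})$ with $h'\in H_{\sigma\bar d}$ and $\sigma_2,\dots,\sigma_{d_0}$ rooted automorphisms of $T_{\sigma\bar d}$; thus $H_{\bar d}\cong\prod_{l\ge1}S_{d_l}^{\,d_{l-1}-1}$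 (the coordinates $\sigma_2,\dots,\sigma_{d_0}$ giving the factors $S_{d_1}$, the rest recursively from $h'$). For a finite group $F$, $F\wr_{\partial T_{\bar d}}\mathrm{Aut}(T_{\bar d})=\{\varphi:\partial T_{\bar d}\to F\}\rtimes\mathrm{Aut}(T_{\bar d})$ with $(g.\varphi)(x)=\varphi(g(x))$ and $(\varphi g)(\varphi'g')=\varphi(g.\varphi')gg'$; $\varphi_f$ ($f\in F$) equals $f$ at $1^\infty$ and is trivial elsewhere. A finitely generated saturated directed group $\Gamma(S_{d_0},HF)$ is the subgroup of this wreath product generated by the rooted group $S_{d_0}$, a finite subgroup $H\le H_{\bar d}$ such that the pushforward of the uniform measure on $H$ to each factor $S_{d_l}$ is uniform, and $\{\varphi_f:f\in F\}$; $HF=\{h\varphi_f\}\cong H\times F$. The measure $\mu$ is the law of $sks'$ with $s,s'$ uniform on $S_{d_0}$ and $k$ uniform on $HF$, independent (''equidistributed on $S_{d_0}HFS_{d_0}$''). $H_{\Gamma,\mu}(n)=-\sum_\gamma\mu^{*n}(\gamma)\log\mu^{*n}(\gamma)$. Exponent sequence: $p_i=\frac{d_i-1}{d_i^2}$, $k(n)=\min\{k\ge0:p_0p_1\cdots p_kn\le1\}$, $\beta(n)=\frac{\log(d_0d_1\cdots d_{k(n)})}{\log n}$. *)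

(* Defs.v *)
From HB Require Import structures.
From Stdlib Require Import Reals ClassicalEpsilon.
From mathcomp Require Import all_boot all_fingroup.
Set Implicit Arguments. Unset Strict Implicit. Unset Printing Implicit Defensive.

(* Letters at level j are 0..d j - 1; the paper's letter t corresponds to t-1,
   so the paper's ray 1^oo is the constant-0 ray. *)

Definition bnd (d : nat -> nat) : Type := forall j : nat, 'I_(d j).

(* Coordinates of an element of H_d = prod_{l>=1} S_{d_l}^{d_{l-1}-1}:
   c l t (for 1 <= t < d l, 0-indexed letter) is the permutation in S_{d (l+1)};
   the coordinate t = 0 is a dummy (required to be 1 by hypothesis). *)
Definition Hcoord (d : nat -> nat) : Type :=
  forall l : nat, 'I_(d l) -> {perm 'I_(d l.+1)}.

(* action of the element of H_d with coordinates c on rays: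
   x = 1^m t y (t <> 1 at position m)  |->  1^m t c_m,t(y_0) y_1 ... *)
Definition hact (d : nat -> nat) (c : Hcoord d) (x : bnd d) : bnd d :=
  fun j => match j as j0 return 'I_(d j0) with
  | 0 => x 0
  | m.+1 => if [forall i : 'I_m, nat_of_ord (x (nat_of_ord i)) == 0]
                && (nat_of_ord (x m) != 0)
            then c m (x m) (x m.+1) else x m.+1
  end.

Definition ract (d : nat -> nat) (s : {perm 'I_(d 0)}) (x : bnd d) : bnd d :=
  fun j => match j as j0 return 'I_(d j0) with
  | 0 => s (x 0)
  | m.+1 => x m.+1
  end.

(* elements of F wr_{boundary} Aut(T_d): pairs (phi, g), g given by its
   action on the boundary; (g.phi)(x) = phi(g x), (gf)(x) = f(g(x)). *)
Record welt (d : nat -> nat) (F : finGroupType) :=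
  WElt { wphi : bnd d -> F; wact : bnd d -> bnd d }.

Definition wmul (d : nat -> nat) (F : finGroupType) (a b : welt d F) : welt d F :=
  WElt (fun x => (wphi a x * wphi b (wact a x))%g) (fun x => wact b (wact a x)).

Definition wone (d : nat -> nat) (F : finGroupType) : welt d F :=
  WElt (fun _ => 1%g) (fun x => x).

Definition weq (d : nat -> nat) (F : finGroupType) (a b : welt d F) : Prop :=
  forall x, wphi a x = wphi b x /\ wact a x = wact b x.

Definition is_root_ray (d : nat -> nat) (x : bnd d) : Prop :=
  forall j, nat_of_ord (x j) = 0.

Definition phi_f (d : nat -> nat) (F : finGroupType) (f : F) : bnd d -> F :=
  fun x => if excluded_middle_informative (is_root_ray x) then f else 1%g.

Definition wroot (d : nat -> nat) (F : finGroupType) (s : {perm 'I_(d 0)}) : welt d F :=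
  WElt (fun _ => 1%g) (ract s).
Definition wH (d : nat -> nat) (F : finGroupType) (c : Hcoord d) : welt d F :=
  WElt (fun _ => 1%g) (hact c).
Definition wphif (d : nat -> nat) (F : finGroupType) (f : F) : welt d F :=
  WElt (phi_f f) (fun x => x).

(* one step s * (h phi_f) * s' of the random walk; the step space is
   S_{d0} x I x F x S_{d0}, with uniform measure *)
Definition Omega (d : nat -> nat) (I : finType) (F : finGroupType) : finType :=
  ({perm 'I_(d 0)} * I * F * {perm 'I_(d 0)})%type.

Definition step (d : nat -> nat) (I : finType) (F : finGroupType)
  (hc : I -> Hcoord d) (o : Omega d I F) : welt d F :=
  let: (s, i, f, s') := o in
  wmul (wmul (wmul (wroot F s) (wH F (hc i))) (wphif d f)) (wroot F s').

Definition wprod (d : nat -> nat) (I : finType) (F : finGroupType)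
  (hc : I -> Hcoord d) (w : seq (Omega d I F)) : welt d F :=
  foldl (fun acc o => wmul acc (step hc o)) (wone d F) w.

Definition prop_b (P : Prop) : bool :=
  if excluded_middle_informative P then true else false.

(* number of step sequences giving the same group element as w;
   mu^{*n}(prod w) = count_same w / #|Omega|^n *)
Definition count_same (d : nat -> nat) (I : finType) (F : finGroupType)
  (hc : I -> Hcoord d) (n : nat) (w : n.-tuple (Omega d I F)) : nat :=
  #|[set w' : n.-tuple (Omega d I F) | prop_b (weq (wprod hc w') (wprod hc w))]|.

(* Shannon entropy H_{Gamma,mu}(n) = - sum_g mu^n(g) log mu^n(g)
   = sum_w N^{-n} log (N^n / count_same w) *)
Definition entropy (d : nat -> nat) (I : finType) (F : finGroupType)
  (hc : I -> Hcoord d) (n : nat) : R :=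
  let N := INR (#|Omega d I F| ^ n) in
  foldr Rplus R0
    (map (fun w : n.-tuple (Omega d I F) =>
            Rmult (Rinv N) (ln (Rdiv N (INR (count_same hc w)))))
         (enum [set: n.-tuple (Omega d I F)])).

Definition pcoef (d : nat -> nat) (i : nat) : R :=
  Rdiv (Rminus (INR (d i)) R1) (pow (INR (d i)) 2).

Fixpoint pprod (d : nat -> nat) (k : nat) : R :=
  match k with
  | 0 => pcoef d 0
  | k'.+1 => Rmult (pprod d k') (pcoef d k'.+1)
  end.

Fixpoint ksearch (d : nat -> nat) (n fuel k : nat) : nat :=
  match fuel with
  | 0 => k
  | f.+1 => if Rle_dec (Rmult (pprod d k) (INR n)) R1 then k
            else ksearch d n f k.+1
  end.

(* k(n) = min {k >= 0 : p_0 ... p_k n <= 1}; since p_i <= 1/4 the minimum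
   is <= n, so a search over 0..n finds it. *)
Definition kfun (d : nat -> nat) (n : nat) : nat := ksearch d n n.+1 0.

Definition beta (d : nat -> nat) (n : nat) : R :=
  Rdiv (ln (INR (\prod_(0 <= j < (kfun d n).+1) d j))) (ln (INR n)).

(* Main.v *)
(** Put V_L = d_0...d_{L-1} and q_L = prod_{i<L} (d_i - 1)/d_i, so that
    p_0...p_k = q_{k+1} / V_{k+1}. Along the walk, the prefix of length L of a ray
    is a Markov chain on the V_L vertices of level L, preserving the counting
    measure: at each time exactly one vertex is at 0^L.

    Upper bound, at level L = k(n) + 1. The section of the walk at a vertex is an
    alternating product of elements of HF (at visits of 0^L) and of rooted
    permutations (at visits of 0^{L-1} t, t <> 0). The chance that a visit of 0^L
    is followed by a visit of some 0^{L-1} t before the return to 0^L is q_L, so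
    all sections together have expected length at most 2 V_L + 2 n q_L <= 4 V_L,
    and Gibbs' inequality gives an entropy O(V_L ln V_L) = O(V_L ln n).

    Lower bound, at a level L with k(n) - L bounded. Given the rest of the walk, the
    lamps at the last visits of 0^L are independent and uniform, so the entropy is
    at least ln #|F| times the expected number of vertices that visit 0^L. The
    expected hitting time of 0^L is explicit and at most n/2, hence at least half of
    the V_L vertices are expected to visit 0^L.

    Thus the entropy is V_{k(n)+1} = n^{beta(n)} up to a factor O(ln n). *)

Require Import Defs.
From HB Require Import structures.
From Stdlib Require Import Reals ClassicalEpsilon FunctionalExtensionality.
From mathcomp Require Import all_boot all_fingroup.
From mathcomp Require Import all_order all_algebra ring lra zify Rstruct.
Set Implicit Arguments. Unset Strict Implicit. Unset Printing Implicit Defensive.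
Import Order.TTheory GRing.Theory Num.Theory.
Local Notation ract := Defs.ract.
Local Notation pprod := Defs.pprod.

Local Open Scope ring_scope.

(** * Averages over finite types *)

Section Averages.
Variable K : realFieldType.

Definition av (T : finType) (G : T -> K) : K := (\sum_(t : T) G t) / #|T|%:R.

Lemma eq_av (T : finType) (G G' : T -> K) : G =1 G' -> av G = av G'.
Proof. by move=> e; congr (_ / _); apply: eq_bigr. Qed.

Lemma av_le (T : finType) (G G' : T -> K) :
  (forall t, G t <= G' t) -> av G <= av G'.
Proof. by move=> h; apply: ler_wpM2r; rewrite ?invr_ge0 ?ler0n //; apply: ler_sum. Qed.

Lemma avD (T : finType) (G G' : T -> K) : av (fun t => G t + G' t) = av G + av G'.
Proof. by rewrite /av big_split mulrDl. Qed.

Lemma avN (T : finType) (G : T -> K) : av (fun t => - G t) = - av G.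
Proof. by rewrite /av sumrN mulNr. Qed.

Lemma avB (T : finType) (G G' : T -> K) : av (fun t => G t - G' t) = av G - av G'.
Proof. by rewrite avD avN. Qed.

Lemma avZ (T : finType) (c : K) (G : T -> K) : av (fun t => c * G t) = c * av G.
Proof. by rewrite /av -mulr_sumr mulrA. Qed.

Lemma avZr (T : finType) (c : K) (G : T -> K) : av (fun t => G t * c) = av G * c.
Proof. by rewrite mulrC -avZ; apply: eq_av => t; rewrite mulrC. Qed.

Lemma av_cst (T : finType) (c : K) : (0 < #|T|)%N -> av (fun _ : T => c) = c.
Proof.
move=> h; rewrite /av sumr_const -[c *+ _]mulr_natr mulfK // pnatr_eq0.
by rewrite -lt0n.
Qed.

Lemma av_ge0 (T : finType) (G : T -> K) : (forall t, 0 <= G t) -> 0 <= av G.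
Proof. by move=> h; rewrite divr_ge0 ?ler0n ?sumr_ge0. Qed.

Lemma av_sum (T J : finType) (P : pred J) (G : J -> T -> K) :
  av (fun t => \sum_(j | P j) G j t) = \sum_(j | P j) av (G j).
Proof. by rewrite /av exchange_big /= mulr_suml. Qed.

Lemma av_exchange (T T' : finType) (G : T -> T' -> K) :
  av (fun t => av (G t)) = av (fun t' => av (G ^~ t')).
Proof.
by rewrite /av -!mulr_suml exchange_big /= -!mulrA; congr (_ * _); rewrite mulrC.
Qed.

Lemma av_pair (T T' : finType) (G : T * T' -> K) :
  av G = av (fun t => av (fun t' => G (t, t'))).
Proof.
rewrite /av -mulr_suml -mulrA pair_bigA /=; congr (_ * _).
  by apply: eq_bigr; case.
by rewrite card_prod natrM invfM mulrC.
Qed.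

Lemma av_inj (T : finType) (h : T -> T) (G : T -> K) :
  injective h -> av (fun t => G (h t)) = av G.
Proof. by move=> hi; rewrite /av [in RHS](reindex_inj hi). Qed.

Lemma av_unif (T T' : finType) (h : T -> T') (G : T' -> K) : (0 < #|T|)%N ->
  (forall t', #|[set t | h t == t']| * #|T'| = #|T|)%N ->
  av (fun t => G (h t)) = av G.
Proof.
move=> T0 hu; rewrite /av (partition_big h predT) //= !mulr_suml.
apply: eq_bigr => t' _; under eq_bigr => t /eqP -> do [].
rewrite sumr_const -[_ *+ _]mulr_natr -(hu t') -cardsE natrM.
have : (0 < #|[set t | h t == t']| * #|T'|)%N by rewrite hu.
rewrite muln_gt0 !lt0n => /andP[c0 c1].
by field; rewrite !pnatr_eq0 c0 c1.
Qed.

(** Multiplying by the transposition of [x] and [y] shows that the average does not depend on [x];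
    averaging over [x] as well and exchanging the two averages leaves [av G]. *)
Lemma av_perm (T : finType) (x : T) (G : T -> K) :
  av (fun p : {perm T} => G (p x)) = av G.
Proof.
have hz (y : T) : av (fun p : {perm T} => G (p x)) = av (fun p : {perm T} => G (p y)).
  rewrite -(av_inj (fun p : {perm T} => G (p x)) (mulgI (tperm x y))).
  by apply: eq_av => p; rewrite permM tpermL.
have T0 : (0 < #|T|)%N by apply/card_gt0P; exists x.
rewrite -(av_cst (av (fun p : {perm T} => G (p x))) T0) (eq_av hz) av_exchange.
rewrite (eq_av (G' := fun _ => av G)) ?av_cst //.
- by apply/card_gt0P; exists 1%g.
by move=> p; rewrite av_inj //; apply: perm_inj.
Qed.

(** Recursing on the first letter turns every estimate along the walk into an induction on [n] in
    which the starting ray changes; [ex_tuple] recovers the uniform average over tuples. *)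
Fixpoint ex (T : finType) n (G : seq T -> K) : K :=
  match n with
  | 0 => G [::]
  | n'.+1 => av (fun o => ex n' (fun w => G (o :: w)))
  end.

Lemma ex_le (T : finType) n (G G' : seq T -> K) :
  (forall w, size w = n -> G w <= G' w) -> ex n G <= ex n G'.
Proof.
elim: n G G' => [|n IH] G G' h /=; first exact: h.
by apply: av_le => o; apply: IH => w sw; apply: h => /=; rewrite sw.
Qed.

Lemma eq_ex (T : finType) n (G G' : seq T -> K) :
  (forall w, size w = n -> G w = G' w) -> ex n G = ex n G'.
Proof. by move=> h; apply/le_anti; rewrite !ex_le // => w /h ->. Qed.

Lemma exD (T : finType) n (G G' : seq T -> K) :
  ex n (fun w => G w + G' w) = ex n G + ex n G'.
Proof.
by elim: n G G' => [|n IH] G G' //=; rewrite -avD; apply: eq_av => o; rewrite IH.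
Qed.

Lemma exZ (T : finType) n (c : K) (G : seq T -> K) :
  ex n (fun w => c * G w) = c * ex n G.
Proof.
by elim: n G => [|n IH] G //=; rewrite -avZ; apply: eq_av => o; rewrite IH.
Qed.

Lemma ex_cst (T : finType) n (c : K) : (0 < #|T|)%N -> ex n (fun _ : seq T => c) = c.
Proof.
by move=> T0; elim: n => //= n IH; rewrite (eq_av (fun=> IH)) av_cst.
Qed.

Lemma ex_sum (T J : finType) n (G : J -> seq T -> K) :
  ex n (fun w => \sum_j G j w) = \sum_j ex n (G j).
Proof.
elim: n G => [|n IH] G //=; rewrite -av_sum; apply: eq_av => o.
exact: (IH (fun j w => G j (o :: w))).
Qed.

Lemma ex_tuple (T : finType) n (G : seq T -> K) :
  ex n G = (\sum_(w : n.-tuple T) G w) / (#|T| ^ n)%:R.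
Proof.
elim: n G => [|n IH] G /=.
  rewrite expn0 divr1 (big_pred1 [tuple]) // => w; exact/esym/eqP/tuple0.
rewrite /av (eq_bigr _ (fun o _ => IH _)) -mulr_suml expnSr natrM invfM mulrA.
congr (_ / _ / _); rewrite pair_bigA /=.
rewrite (reindex (fun p : T * n.-tuple T => [tuple of p.1 :: p.2])) //=.
exists (fun w : n.+1.-tuple T => (thead w, [tuple of behead w])).
  by move=> [o w] _; congr (_, _); apply: val_inj.
by move=> w _; rewrite -tuple_eta.
Qed.

End Averages.

(** * Rays and their prefixes *)

Section Rays.
Variable d : nat -> nat.
Implicit Types x y : bnd d.

Lemma bnd_ext x y : (forall j, x j = y j) -> x = y.
Proof. exact: functional_extensionality_dep. Qed.

Definition zpre m x : bool := [forall i : 'I_m, nat_of_ord (x (nat_of_ord i)) == 0%N].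

Lemma zpreP m x : reflect (forall j, (j < m)%N -> x j = 0%N :> nat) (zpre m x).
Proof.
apply: (iffP forallP) => h j; last exact/eqP/h.
by move=> jm; apply/eqP/(h (Ordinal jm)).
Qed.

Lemma zpre0 x : zpre 0 x.
Proof. by apply/zpreP. Qed.

Lemma zpreS m x : zpre m.+1 x = zpre m x && (nat_of_ord (x m) == 0%N).
Proof.
apply/zpreP/andP => [h | [/zpreP h /eqP h0] j].
  by split; [apply/zpreP => j jm; apply/h/leqW | rewrite h].
by rewrite ltnS leq_eqVlt => /predU1P[->|/h].
Qed.

Lemma hactS c x m : hact c x m.+1 =
  if zpre m x && (nat_of_ord (x m) != 0%N) then c m (x m) (x m.+1) else x m.+1.
Proof. by []. Qed.

Lemma ractS s x m : ract s x m.+1 = x m.+1.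
Proof. by []. Qed.

Lemma hact_fix c x m : zpre m x -> forall j, (j <= m)%N -> hact c x j = x j.
Proof.
move=> /zpreP h [|j] // jm; rewrite hactS h //= ?andbF //.
Qed.

Lemma hact_zpre c x m : zpre m (hact c x) = zpre m x.
Proof.
elim: m => [|m IH]; first by rewrite !zpre0.
by rewrite !zpreS IH; case: (boolP (zpre m x)) => //= /(hact_fix c) ->.
Qed.

Definition eqpre L x y := forall j, (j < L)%N -> x j = y j.

Lemma eqpre_zpre L m x y : (m <= L)%N -> eqpre L x y -> zpre m x = zpre m y.
Proof.
move=> mL h; apply/zpreP/zpreP => z j jm; move: (z j jm).
  by rewrite (h j) // (leq_trans jm).
by rewrite -(h j) // (leq_trans jm).
Qed.

Lemma eqpre_hact L c x y : eqpre L x y -> eqpre L (hact c x) (hact c y).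
Proof.
move=> h [|j] jL; first exact: (h 0%N).
rewrite !hactS (eqpre_zpre (ltnW (ltnW jL)) h) (h j) ?(ltnW jL) //.
by rewrite (h _ jL).
Qed.

Lemma eqpre_ract L s x y : eqpre L x y -> eqpre L (ract s x) (ract s y).
Proof.
move=> h [|j] jL; last exact: (h j.+1).
by rewrite /= (h 0%N).
Qed.

(** The letters before a position decide which permutation acts there, and that permutation is
    injective. *)
Lemma hact_inj_pre L c x y : eqpre L (hact c x) (hact c y) -> eqpre L x y.
Proof.
elim: L => [|L IH] h j //.
have {IH}IH : eqpre L x y by apply: IH => i iL; apply: h; apply: leqW.
rewrite ltnS leq_eqVlt => /predU1P[->|]; last exact: IH.
case: L h IH => [|L] h IH; first exact: (h 0%N).
have := h L.+1 (leqnn _); rewrite !hactS (eqpre_zpre (leqnSn L) IH) (IH L) //.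
by case: ifP => // _ /perm_inj.
Qed.

Lemma ract_inj_pre L s x y : eqpre L (ract s x) (ract s y) -> eqpre L x y.
Proof.
move=> h [|j] jL; last exact: (h j.+1).
by have := h 0%N jL; rewrite /= => /perm_inj.
Qed.

Lemma ractM s s' x : ract s' (ract s x) = ract (s * s')%g x.
Proof. by apply: bnd_ext => -[|j] //=; rewrite permM. Qed.

Lemma ract1 x : ract 1%g x = x.
Proof. by apply: bnd_ext => -[|j] //=; rewrite perm1. Qed.

End Rays.

(** * The induced chain on prefixes *)

Section Chain.
Variables (K : realFieldType) (d : nat -> nat) (hd2 : forall j, (2 <= d j)%N).
Variables (F : finGroupType) (I : finType) (hc : I -> Hcoord d).
Arguments hc : clear implicits.
Hypothesis I_gt0 : (0 < #|I|)%N.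
Hypothesis hc_unif : forall l (t : 'I_(d l)), (0 < nat_of_ord t)%N ->
      forall p : {perm 'I_(d l.+1)},
        (#|[set i | hc i l t == p]| * #|{perm 'I_(d l.+1)}| = #|I|)%N.
Local Notation X := (bnd d).
Local Notation Om := (Omega d I F).
Implicit Types (x y z : X) (g : X -> K).

Lemma card_perm_gt0 (T : finType) : (0 < #|{perm T}|)%N.
Proof. by apply/card_gt0P; exists 1%g. Qed.

Lemma card_group_gt0 : (0 < #|F|)%N.
Proof. by apply/card_gt0P; exists 1%g. Qed.

Lemma card_Om_gt0 : (0 < #|Om|)%N.
Proof. by rewrite !card_prod !muln_gt0 !card_perm_gt0 I_gt0 card_group_gt0. Qed.

(* A step o moves a ray x to y = [pre_act o x], just before the H-factor acts, then
   to [post_act o y]. Averaging over the leading rooted factor of the step is [A];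
   [T g y] is the mean of [A g] after the step leaves y. *)
Definition pre_act (o : Om) x : X := ract o.1.1.1 x.
Definition post_act (o : Om) y : X := ract o.2 (hact (hc o.1.1.2) y).

Local Notation pre := pre_act.
Local Notation post := post_act.

Definition A g x : K := av (fun s => g (ract s x)).
Definition T g y : K := av (fun i => A g (hact (hc i) y)).

Lemma A_ract s g x : A g (ract s x) = A g x.
Proof.
rewrite -[RHS](av_inj _ (mulgI s)); apply: eq_av => s'.
by rewrite ractM.
Qed.

Lemma A_le g g' x : (forall y, g y <= g' y) -> A g x <= A g' x.
Proof. by move=> h; apply: av_le. Qed.

Lemma A_cst c x : A (fun _ => c) x = c.
Proof. by rewrite /A av_cst // card_perm_gt0. Qed.

Lemma eq_T g g' y :
  (forall i s, g (ract s (hact (hc i) y)) = g' (ract s (hact (hc i) y))) ->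
  T g y = T g' y.
Proof. by move=> h; apply: eq_av => i; apply: eq_av => s. Qed.

Lemma T_cst c y : T (fun _ => c) y = c.
Proof. by rewrite /T (eq_av (fun i => A_cst _ _)) av_cst. Qed.

Lemma TD g g' y : T (fun z => g z + g' z) y = T g y + T g' y.
Proof. by rewrite -avD; apply: eq_av => i; rewrite -avD. Qed.

Lemma TZ c g y : T (fun z => c * g z) y = c * T g y.
Proof. by rewrite -avZ; apply: eq_av => i; rewrite -avZ. Qed.

Lemma T_affine g a b y :
  T (fun z => g z * a + (1 - g z) * b) y = T g y * a + (1 - T g y) * b.
Proof.
rewrite (@eq_T _ (fun z => (a - b) * g z + b)); last by move=> i s; ring.
by rewrite TD TZ T_cst; ring.
Qed.

Lemma av_Om (G : {perm 'I_(d 0)} -> I -> {perm 'I_(d 0)} -> K) :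
  av (fun o : Om => G o.1.1.1 o.1.1.2 o.2) = av (fun s => av (fun i => av (G s i))).
Proof.
rewrite !av_pair; apply: eq_av => s; apply: eq_av => i /=.
by rewrite av_cst // card_group_gt0.
Qed.

(** The trailing rooted factor of a step is absorbed by the leading one of the next ([A_ract]), so a
    step acts on averaged functions through [T] alone. *)
Lemma av_step (b : X -> K) g x :
  av (fun o : Om => b (pre o x) * A g (post o (pre o x))) = A (fun y => b y * T g y) x.
Proof.
rewrite (av_Om (fun s i s' => b (ract s x) * A g (ract s' (hact (hc i) (ract s x))))).
apply: eq_av => s; rewrite -avZ; apply: eq_av => i.
rewrite avZ; congr (_ * _); rewrite -[RHS](av_cst _ (card_perm_gt0 'I_(d 0))).
by apply: eq_av => s'; rewrite A_ract.
Qed.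

Lemma av_pre (b : X -> K) x : av (fun o : Om => b (pre o x)) = A b x.
Proof.
rewrite (av_Om (fun s i s' => b (ract s x))); apply: eq_av => s.
by rewrite !av_cst // card_perm_gt0.
Qed.

Definition r j : K := ((d j)%:R - 1) / (d j)%:R.
Fixpoint q j : K := if j is j'.+1 then q j' * r j' else 1.
Definition V L : nat := \prod_(0 <= j < L) d j.

Lemma d_gt1 j : 1 < (d j)%:R :> K.
Proof. by rewrite ltr1n. Qed.

Lemma r_gt0 j : 0 < r j.
Proof. by have := d_gt1 j => h; apply: divr_gt0; lra. Qed.

Lemma r_le1 j : r j <= 1.
Proof. by have := d_gt1 j => h; rewrite ler_pdivrMr; lra. Qed.

Lemma q_gt0 j : 0 < q j.
Proof. by elim: j => [|j IH] //=; rewrite mulr_gt0 // r_gt0. Qed.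

Lemma V_gt0 L : (0 < V L)%N.
Proof. by rewrite prodn_gt0 // => j; apply: leq_trans (hd2 j). Qed.

Lemma VS L : V L.+1 = (V L * d L)%N.
Proof. by rewrite /V big_nat_recr. Qed.

Lemma av_nz n : (0 < n)%N ->
  av (fun t : 'I_n => (nat_of_ord t != 0%N)%:R) = (n%:R - 1) / n%:R :> K.
Proof.
case: n => // n _; rewrite /av card_ord big_ord_recl /= add0r.
by rewrite sumr_const card_ord; congr (_ / _); rewrite -[n.+1%:R]natr1 addrK.
Qed.

Lemma hc_nz l (t : 'I_(d l)) (z : 'I_(d l.+1)) : (0 < nat_of_ord t)%N ->
  av (fun i => (nat_of_ord (hc i l t z) != 0%N)%:R) = r l.+1.
Proof.
move=> t0; rewrite (@av_unif _ _ _ (fun i => hc i l t)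
  (fun p : {perm 'I_(d l.+1)} => (nat_of_ord (p z) != 0%N)%:R) I_gt0 (hc_unif t0)).
rewrite (av_perm z (fun u : 'I_(d l.+1) => (nat_of_ord u != 0%N)%:R)) av_nz //.
exact: leq_trans (hd2 _).
Qed.

(* [ud j x] is the probability that the letter j of the ray x is nonzero at the
   first visit of its prefix of length j to 0^j. *)
Fixpoint ud j x : K :=
  if j is j'.+1 then ud j' x * r j + (1 - ud j' x) * (nat_of_ord (x j) != 0%N)%:R
  else (nat_of_ord (x 0%N) != 0%N)%:R.

Lemma udS j x :
  ud j.+1 x = ud j x * r j.+1 + (1 - ud j x) * (nat_of_ord (x j.+1) != 0%N)%:R.
Proof. by []. Qed.

Lemma ud_eqpre j x y : eqpre j.+1 x y -> ud j x = ud j y.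
Proof.
elim: j => [|j IH] h /=; first by rewrite (h 0%N).
by rewrite IH ?(h j.+1) // => i ij; apply: h; apply: leqW.
Qed.

Lemma ud_ge0le1 j x : 0 <= ud j x <= 1.
Proof.
elim: j => [|j /andP[h0 h1]] /=; first by case: eqP => _ /=; apply/andP; split; lra.
have h2 := r_gt0 j.+1; have h3 := r_le1 j.+1.
by case: eqP => _ /=; apply/andP; split; nra.
Qed.

Lemma ud_zpre j x : zpre j.+1 x -> ud j x = 0.
Proof.
elim: j => [|j IH]; first by rewrite zpreS => /andP[_ /eqP /= ->].
by rewrite zpreS => /andP[/IH h /eqP e] /=; rewrite h e /=; ring.
Qed.

Lemma ud_exit j x : zpre j x -> nat_of_ord (x j) != 0%N -> ud j x = 1.
Proof.
case: j => [|j] /=; first by move=> _ ->.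
by move=> /ud_zpre -> -> /=; ring.
Qed.

(** Before the walk is back at 0^j, letter [j] is redrawn uniformly with probability q_j and
    otherwise keeps its value. A zero letter thus becomes nonzero with probability q_j r_j, and a
    nonzero one is still nonzero with probability 1 - q_j + q_j r_j. Off 0^j the first visit is
    still ahead, so [ud j] is harmonic there. *)
Lemma T_ud j y : T (ud j) y =
  if zpre j y then if nat_of_ord (y j) == 0%N then q j.+1 else 1 - q j / (d j)%:R
  else ud j y.
Proof.
elim: j => [|j IH].
  rewrite zpre0 /=.
  have -> : T (ud 0) y = r 0.
    rewrite -[RHS](av_cst _ I_gt0); apply: eq_av => i.
    rewrite /A /= (av_perm (hact (hc i) y 0%N) (fun t : 'I_(d 0) => (nat_of_ord t != 0%N)%:R)).
    by rewrite av_nz //; apply: leq_trans (hd2 _).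
  case: eqP => _; first by rewrite mul1r.
  by rewrite /r; field; have := d_gt1 0; lra.
(* This is the only case in which the H-factor redraws letter [j.+1]. It fixes the letters up to
   [j], so for a given rooted factor the average over [i] concerns letter [j.+1] alone. *)
have [/andP[zj yj]|nexit] := boolP (zpre j y && (nat_of_ord (y j) != 0%N)).
  have udE i s : ud j.+1 (ract s (hact (hc i) y)) = ud j (ract s y) * r j.+1 +
      (1 - ud j (ract s y)) * (nat_of_ord (hc i j (y j) (y j.+1)) != 0%N)%:R.
    rewrite udS ractS hactS zj yj /=.
    suff -> : ud j (ract s (hact (hc i) y)) = ud j (ract s y) by [].
    by apply/ud_eqpre/eqpre_ract => k kj; apply: hact_fix zj _ kj.
  rewrite zpreS zj /= (negbTE yj) (ud_exit zj yj) subrr mul0r addr0 mul1r.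
  rewrite /T /A (eq_av (fun i => eq_av (udE i))) av_exchange.
  rewrite -[RHS](av_cst _ (card_perm_gt0 'I_(d 0))); apply: eq_av => s.
  by rewrite avD av_cst // avZ hc_nz ?lt0n //; ring.
(* In the other cases letter [j.+1] does not move, and [ud j.+1] is an affine function of [ud j]
   with constant coefficients. *)
have tailE i s : ud j.+1 (ract s (hact (hc i) y)) =
    ud j (ract s (hact (hc i) y)) * r j.+1 +
    (1 - ud j (ract s (hact (hc i) y))) * (nat_of_ord (y j.+1) != 0%N)%:R.
  by rewrite udS ractS hactS (negbTE nexit).
rewrite (eq_T (g' := fun z => ud j z * r j.+1 +
   (1 - ud j z) * (nat_of_ord (y j.+1) != 0%N)%:R) tailE) T_affine IH zpreS.
case: (boolP (zpre j y)) nexit => [zj|_ _] /=; last by [].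
rewrite negbK => ->; case: eqP => _ /=; first by ring.
by rewrite /r; field; have := d_gt1 j.+1; have := d_gt1 j; lra.
Qed.

Fixpoint visits L x (w : seq Om) : nat :=
  if w is o :: w' then (zpre L (pre o x) + visits L (post o (pre o x)) w')%N else 0.

Lemma post_pre_inj_pre L o x y :
  eqpre L (post o (pre o x)) (post o (pre o y)) -> eqpre L x y.
Proof. by move=> /ract_inj_pre /hact_inj_pre /ract_inj_pre. Qed.

(** A step is injective on prefixes, so the prefixes stay distinct and at each time at most one of
    them equals 0^L. *)
Lemma sum_visits (J : finType) L (X0 : J -> X) w :
  (forall i j, eqpre L (X0 i) (X0 j) -> i = j) ->
  (\sum_j visits L (X0 j) w <= size w)%N.
Proof.
elim: w X0 => [|o w IH] X0 inj /=; first by rewrite big1.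
rewrite big_split /= -add1n leq_add //; last first.
  by apply: IH => i j h; apply/inj/(post_pre_inj_pre h).
have -> : (\sum_j zpre L (pre o (X0 j)) = #|[pred j | zpre L (pre o (X0 j))]|)%N.
  by rewrite -sum1_card [RHS]big_mkcond /=; apply: eq_bigr => j _; rewrite inE; case: zpre.
apply/card_le1P => i; rewrite inE => /zpreP zi j; rewrite !inE.
apply/idP/eqP => [/zpreP zj|->]; last by apply/zpreP.
apply: inj; apply: (@ract_inj_pre _ _ o.1.1.1) => k kL.
by apply: val_inj; rewrite /= zj // zi.
Qed.

(* Number of passages from 0^(j+1) to 0^j t with t <> 0, counting only visits of
   0^j; the flag records whether the last such visit was at 0^(j+1). *)
Fixpoint exits j x (fl : bool) (w : seq Om) : nat :=
  if w is o :: w' then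
    let y := pre o x in
    if zpre j y then
      if nat_of_ord (y j) == 0%N then exits j (post o y) true w'
      else (fl + exits j (post o y) false w')%N
    else exits j (post o y) fl w'
  else 0.

(** The first term pays for a passage pending at the start, which is completed when the next visit
    of 0^j has a nonzero letter [j]. Each visit of 0^(j+1) leaves one passage pending, and by [T_ud]
    it is completed with probability q_(j+1). *)
Lemma ex_exits n j x fl :
  ex n (fun w => (exits j x fl w)%:R) <=
  fl%:R * A (ud j) x + q j.+1 * ex n (fun w => (visits j.+1 x w)%:R).
Proof.
elim: n x fl => [|n IH] x fl.
  rewrite /= mulr0 addr0 mulr_ge0 ?ler0n //; apply: av_ge0 => s.
  by case/andP: (ud_ge0le1 j (ract s x)).
pose W z := ex n (fun w => (visits j.+1 z w)%:R) : K.
have WE : ex n.+1 (fun w => (visits j.+1 x w)%:R) =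
    av (fun o : Om => (zpre j.+1 (pre o x))%:R) +
    av (fun o : Om => W (post o (pre o x))).
  rewrite -avD; apply: eq_av => o /=.
  rewrite -[X in _ = X + _](ex_cst n _ card_Om_gt0) -exD; apply: eq_ex => w _.
  by rewrite natrD.
(* Indicators of the position at which the H-factor acts: at 0^(j+1), at 0^j t with t <> 0, or off
   0^j. *)
pose b1 y := (zpre j.+1 y)%:R : K.
pose b2 y := (zpre j y && (nat_of_ord (y j) != 0%N))%:R : K.
pose b3 y := (~~ zpre j y)%:R : K.
have bound o : ex n (fun w => (exits j x fl (o :: w))%:R) <=
   (b1 (pre o x) + b3 (pre o x) * fl%:R) * A (ud j) (post o (pre o x)) +
   (b2 (pre o x) * fl%:R + q j.+1 * W (post o (pre o x))).
  rewrite /b1 /b2 /b3 zpreS /=.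
  case: (zpre j _) => /=; last by rewrite !mul0r !add0r mul1r IH.
  case: eqP => _ /=.
    by rewrite !mul0r addr0 mul1r add0r; apply: le_trans (IH _ _) _; rewrite mul1r.
  rewrite !mul0r add0r mul0r add0r mul1r.
  under eq_ex => w _ do rewrite natrD.
  rewrite exD ex_cst ?card_Om_gt0 // lerD2l.
  by apply: le_trans (IH _ _) _; rewrite mul0r add0r.
apply: le_trans (av_le bound) _.
rewrite avD (av_step (fun y => b1 y + b3 y * fl%:R)) avD.
rewrite (av_pre (fun y => b2 y * fl%:R)) avZ WE (av_pre b1) addrA mulrDr addrA lerD2r.
rewrite /A -avD -!avZ -avD; apply: av_le => s; rewrite -!/(A _ _) T_ud.
rewrite /b1 /b2 /b3 zpreS; case: (boolP (zpre j _)) => z /=; last by lra.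
case: (boolP (nat_of_ord _ == 0%N)) => e /=; last by rewrite ud_exit //; lra.
by rewrite ud_zpre ?zpreS ?z //; lra.
Qed.

(* Expected hitting time of 0^L from x. *)
Definition tau L x : K := \sum_(j < L) (V j.+1)%:R / q j * ud j x.

Lemma tauS L x : tau L.+1 x = tau L x + (V L.+1)%:R / q L * ud L x.
Proof. by rewrite /tau big_ord_recr. Qed.

Lemma tau_zpre L x : zpre L x -> tau L x = 0.
Proof.
move=> /zpreP z; apply: big1 => j _; rewrite ud_zpre ?mulr0 //.
by apply/zpreP => i ij; apply: z; apply: leq_trans ij _.
Qed.

(* Kac's formula in the first case; outside 0^L, [tau L] decreases by one in mean. *)
Lemma T_tau L y : T (tau L) y = if zpre L y then (V L)%:R - 1 else tau L y - 1.
Proof.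
elim: L => [|L IH].
  rewrite zpre0 /V big_geq // subrr -[RHS](T_cst 0 y); apply: eq_T => i s.
  by rewrite /tau big_ord0.
rewrite (eq_T (g' := fun z => tau L z + (V L.+1)%:R / q L * ud L z)); last first.
  by move=> i s; rewrite tauS.
rewrite TD TZ IH T_ud zpreS tauS.
case: (boolP (zpre L y)) => z /=; last by lra.
have d1 := d_gt1 L; have q0 := q_gt0 L; rewrite VS natrM /r.
case: (boolP (nat_of_ord _ == 0%N)) => e; first by field; lra.
by rewrite tau_zpre // ud_exit //; field; lra.
Qed.

Fixpoint hit L x (w : seq Om) : nat :=
  if w is o :: w' then
    if zpre L (pre o x) then 0 else (hit L (post o (pre o x)) w').+1
  else 0.

Lemma hit_novisit L x w : visits L x w = 0%N -> hit L x w = size w.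
Proof.
by elim: w x => //= o w IH x; case: (zpre _ _) => //= /IH ->.
Qed.

(** By [T_tau], the potential [tau L] drops by one in mean at each step before the hit; when the
    word ends first, its nonnegativity suffices. *)
Lemma ex_hit n L x : ex n (fun w => (hit L x w)%:R) <= A (tau L) x.
Proof.
elim: n x => [|n IH] x /=.
  apply: av_ge0 => s; apply: sumr_ge0 => j _.
  rewrite mulr_ge0 ?divr_ge0 ?ler0n ?(ltW (q_gt0 _)) //.
  by case/andP: (ud_ge0le1 j (ract s x)).
pose b y := (~~ zpre L y)%:R : K.
have bound o : ex n (fun w => (hit L x (o :: w))%:R) <=
   b (pre o x) * A (tau L) (post o (pre o x)) + b (pre o x).
  rewrite /b /=; case: (zpre L _) => /=; first by rewrite ex_cst ?card_Om_gt0 ?mul0r ?addr0.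
  under eq_ex => w _ do rewrite -natr1.
  by rewrite exD ex_cst ?card_Om_gt0 // mul1r lerD2r.
apply: le_trans (av_le bound) _; rewrite avD av_step av_pre -avD.
apply: av_le => s; rewrite T_tau /b; case: (boolP (zpre L _)) => z /=; last by lra.
by rewrite tau_zpre //; lra.
Qed.

End Chain.

Local Close Scope ring_scope.

(** * Sections of the walk and their coding *)

Section Words.
Variables (d : nat -> nat) (hd2 : forall j, 2 <= d j).
Variables (F : finGroupType) (I : finType) (hc : I -> Hcoord d).
Arguments hc : clear implicits.
Variable mulI : I -> I -> I.
Hypothesis mulIE : forall i j l t, hc (mulI i j) l t = (hc i l t * hc j l t)%g.
Local Notation X := (bnd d).
Local Notation Om := (Omega d I F).
Local Notation pre := (@pre_act d F I).
Local Notation post := (@post_act d F I hc).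
Implicit Types (x y z : X).

Lemma phi_f_iff (d1 d2 : nat -> nat) (f : F) (x : bnd d1) (y : bnd d2) :
  (is_root_ray x <-> is_root_ray y) -> phi_f f x = phi_f f y.
Proof.
rewrite /phi_f => h; case: excluded_middle_informative => hx;
  case: excluded_middle_informative => hy //; by case: h => h1 h2; exfalso; auto.
Qed.

Lemma phi_f_root (d1 : nat -> nat) (f : F) (x : bnd d1) :
  is_root_ray x -> phi_f f x = f.
Proof. by rewrite /phi_f; case: excluded_middle_informative. Qed.

Lemma phi_f_nroot (d1 : nat -> nat) (f : F) (x : bnd d1) :
  ~ is_root_ray x -> phi_f f x = 1%g.
Proof. by rewrite /phi_f; case: excluded_middle_informative. Qed.

Lemma is_root_zpre (d1 : nat -> nat) (x : bnd d1) :
  is_root_ray x <-> forall m, zpre m x.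
Proof.
split=> [h m|h j]; first by apply/zpreP => j _; apply: h.
by have /zpreP := h j.+1; apply.
Qed.

Lemma is_root_hact (d1 : nat -> nat) c (x : bnd d1) :
  is_root_ray (hact c x) <-> is_root_ray x.
Proof. by rewrite !is_root_zpre; split=> h m; move: (h m); rewrite hact_zpre. Qed.

Definition olamp (o : Om) : F := o.1.2.

Fixpoint pos x (w : seq Om) : X :=
  if w is o :: w' then pos (post o (pre o x)) w' else x.
Fixpoint lamp x (w : seq Om) : F :=
  if w is o :: w' then (phi_f (olamp o) (pre o x) * lamp (post o (pre o x)) w')%g
  else 1%g.

Lemma wprodE w x : wphi (wprod hc w) x = lamp x w /\ wact (wprod hc w) x = pos x w.
Proof.
suff H (acc : welt d F) y :
    wphi (foldl (fun acc o => wmul acc (step hc o)) acc w) y =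
      (wphi acc y * lamp (wact acc y) w)%g /\
    wact (foldl (fun acc o => wmul acc (step hc o)) acc w) y = pos (wact acc y) w.
  by have := H (wone d F) x; rewrite /= mul1g.
elim: w acc => [|[[[s i] f] s'] w IH] acc /=; first by rewrite mulg1.
have [-> ->] := IH (wmul acc (step hc (s, i, f, s'))); split=> //=.
rewrite !mul1g mulg1 mulgA; congr (_ * _ * _)%g.
(* A step reads its lamp after the H-factor, [lamp] reads it before; both agree because the H-factor
   preserves being the root ray. *)
by apply: phi_f_iff; apply: is_root_hact.
Qed.

Lemma eqpre_step L o x y : eqpre L x y ->
  eqpre L (post o (pre o x)) (post o (pre o y)).
Proof. by move=> h; apply/eqpre_ract/eqpre_hact/eqpre_ract. Qed.

Lemma eqpre_pos L w x y : eqpre L x y -> eqpre L (pos x w) (pos y w).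
Proof. by elim: w x y => //= o w IH x y h; apply/IH/eqpre_step. Qed.

Section Level.
Variable j : nat.
Local Notation L := j.+1.

(** With [k + L] instead of [L + k], [dsh k.+1] is convertible to [d (k + L).+1], so [hcs]
    typechecks without casts. *)
Definition dsh k := d (k + L).
Definition tail x : bnd dsh := fun k => x (k + L).
Definition hcs (i : I) : Hcoord dsh := fun l t => hc i (l + L) t.
Arguments hcs : clear implicits.

Lemma tail_inj x y : eqpre L x y -> tail x = tail y -> x = y.
Proof.
move=> h ht; apply: bnd_ext => k; have [/h //|kL] := ltnP k L.
have H m : k = (m + L)%N -> x k = y k.
  by move=> ->; apply: (f_equal (fun u : bnd dsh => u m) ht).
by apply: (H (k - L)); rewrite subnK.
Qed.

Lemma zpre_tail m y : zpre L y -> zpre (m + L) y = zpre m (tail y).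
Proof.
move=> zy; elim: m => [|m IH]; first by rewrite zy zpre0.
by rewrite addSn !zpreS IH.
Qed.

Lemma is_root_tail y : zpre L y -> (is_root_ray y <-> is_root_ray (tail y)).
Proof.
move=> zy; rewrite !is_root_zpre; split=> h m; first by rewrite -zpre_tail.
have [mL|Lm] := ltnP m L; last by rewrite -(subnK Lm) zpre_tail.
by move/zpreP: zy => zy; apply/zpreP => k km; apply: zy; apply: ltn_trans mL.
Qed.

Lemma tail_ract s x : tail (ract s x) = tail x.
Proof.
apply: bnd_ext => k; have H m : 0 < m -> ract s x m = x m by case: m.
by apply: H; rewrite addnS.
Qed.

(** With [tail_hact_exit] and [tail_hact_away] this gives the sections of an H-factor at level [L]:
    a directed element at 0^L, a rooted one at 0^j t with t <> 0, and the identity elsewhere. *)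
Lemma tail_hact_root i y : zpre L y -> tail (hact (hc i) y) = hact (hcs i) (tail y).
Proof.
move=> zy; apply: bnd_ext => -[|k]; first exact: (hact_fix (hc i) zy (leqnn L)).
by rewrite hactS -zpre_tail.
Qed.

Lemma hact_stay c y k :
  (forall m, m.+1 = k -> ~~ (zpre m y && (nat_of_ord (y m) != 0))) ->
  hact c y k = y k.
Proof. by case: k => // k h; rewrite hactS (negbTE (h k _)). Qed.

Lemma tail_hact_exit i y : zpre j y -> nat_of_ord (y j) != 0 ->
  tail (hact (hc i) y) = @Defs.ract dsh (hc i j (y j)) (tail y).
Proof.
move=> zy yj; apply: bnd_ext => -[|k].
  by rewrite /tail /= -/(zpre j y) zy yj.
rewrite /tail; apply: hact_stay => m mk; apply/negP => /andP[/zpreP h _].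
by move: yj; rewrite h //; lia.
Qed.

Lemma tail_hact_away i y : ~~ zpre j y -> tail (hact (hc i) y) = tail y.
Proof.
move=> zy; apply: bnd_ext => k; apply: hact_stay => m mk.
apply: contra zy => /andP[/zpreP h _]; apply/zpreP => l lj; apply: h; lia.
Qed.

(* The nontrivial factors of the section of the walk at a vertex of level [L]:
   [inl] at visits of 0^L, [inr] at visits of 0^j t with t <> 0. *)
Definition letter : finType := ((I * F) + {perm 'I_(d L)})%type.

Fixpoint letters x (w : seq Om) : seq letter :=
  if w is o :: w' then
    let y := pre o x in let s := letters (post o y) w' in
    if zpre j y then
      if nat_of_ord (y j) == 0 then inl (o.1.1.2, olamp o) :: s
      else inr (hc o.1.1.2 j (y j)) :: s
    else s
  else [::].

Definition letter_val (a : letter) : welt dsh F :=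
  match a with
  | inl u => wmul (wH F (hcs u.1)) (wphif dsh u.2)
  | inr p => @wroot dsh F p
  end.

Definition section_val (s : seq letter) : welt dsh F :=
  foldr (fun a b => wmul (letter_val a) b) (wone dsh F) s.

(** Rooted factors do not touch the tail because [L] is positive, and a lamp can change only at 0^L;
    hence each step contributes at most one letter. *)
Lemma section_valE w x :
  lamp x w = wphi (section_val (letters x w)) (tail x) /\
  tail (pos x w) = wact (section_val (letters x w)) (tail x).
Proof.
elim: w x => [|[[[s i] f] s'] w IH] x //=; rewrite /olamp /=.
have [-> ->] := IH (post (s, i, f, s') (pre (s, i, f, s') x)).
set y := pre_act _ x; have -> : tail x = tail y by rewrite tail_ract.
rewrite {2 4}/post_act /= tail_ract.
have [zy|zy] := boolP (zpre j y); last first.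
  rewrite tail_hact_away // phi_f_nroot ?mul1g // => h; move/negP: zy; apply.
  by move/is_root_zpre: h.
have [y0|yj] := boolP (nat_of_ord (y j) == 0).
  have zyL : zpre L y by rewrite zpreS zy.
  rewrite /= tail_hact_root // mul1g; split => //; congr (_ * _)%g.
  by apply: phi_f_iff; rewrite is_root_hact; apply: is_root_tail.
rewrite /= tail_hact_exit // phi_f_nroot // => h; move/negP: yj; apply.
by rewrite (h j).
Qed.

(** Neighbouring letters of the same kind are multiplied in H x F or in the symmetric group, which
    makes the reduced word alternating. *)
Definition push (a : letter) (s : seq letter) : seq letter :=
  match a, s with
  | inl u, inl v :: s' => inl (mulI u.1 v.1, u.2 * v.2)%g :: s'
  | inr p, inr p' :: s' => inr (p * p')%g :: s'
  | _, _ => a :: s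
  end.
Definition reduce : seq letter -> seq letter := foldr push [::].

(** The first factor keeps the leading zeros and the first nonzero letter, so the second one acts at
    the same place through the same coordinate. *)
Lemma hact_mul (d1 : nat -> nat) (c c1 c2 : Hcoord d1) (x : bnd d1) :
  (forall l t, c l t = (c1 l t * c2 l t)%g) -> hact c x = hact c2 (hact c1 x).
Proof.
move=> h; apply: bnd_ext => -[|m] //; rewrite [LHS]hactS [RHS]hactS hact_zpre.
case: (boolP (zpre m x)) => zm; last by rewrite hactS (negbTE zm).
rewrite (hact_fix c1 zm (leqnn m)) hactS zm /=.
by case: eqP => //= _; rewrite h permM.
Qed.

Lemma push_val a s : weq (section_val (push a s)) (wmul (letter_val a) (section_val s)).
Proof.
case: a s => [[i f]|p] [|[[i' f']|p'] s] //= x /=.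
  have hE : hact (hcs (mulI i i')) x = hact (hcs i') (hact (hcs i) x).
    by apply: hact_mul => l t; apply: mulIE.
  rewrite !hE; split=> //; rewrite !mul1g !mulgA; congr (_ * _)%g.
  rewrite (@phi_f_iff _ _ f _ (hact (hcs i') (hact (hcs i) x))); last first.
    by symmetry; apply: is_root_hact.
  have [h|h] := excluded_middle_informative (is_root_ray (hact (hcs i') (hact (hcs i) x))).
    by rewrite !phi_f_root.
  by rewrite !phi_f_nroot ?mulg1.
by rewrite -!ractM !mul1g.
Qed.

Lemma reduce_val s : weq (section_val (reduce s)) (section_val s).
Proof.
elim: s => //= a s IH x; have [-> ->] := push_val a (reduce s) x.
by rewrite /=; have [-> ->] := IH (wact (letter_val a) x).
Qed.

Fixpoint alternations (fl : bool) (s : seq letter) : nat :=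
  match s with
  | [::] => 0
  | inl _ :: s' => alternations true s'
  | inr _ :: s' => fl + alternations false s'
  end.

Lemma alternations_letters x fl w : alternations fl (letters x w) = exits hc j x fl w.
Proof.
elim: w x fl => //= o w IH x fl.
by case: (zpre _ _) => //; case: eqP => _ /=; rewrite IH.
Qed.

(** An alternating word with a passages from [inl] to [inr] has at most 2a + 2 letters. The
    induction also tracks whether the reduced word begins with [inr], which decides if a preceding
    [inl] creates a new passage. *)
Lemma size_reduce s : size (reduce s) <= (alternations false s).*2 + 2.
Proof.
pose hb (t : seq letter) := if t is inr _ :: _ then true else false.
suff : alternations true s = alternations false s + hb (reduce s) /\
       size (reduce s) <= (alternations false s).*2 + 1 + hb (reduce s).
  by case=> _; case: (hb _); lia.
elim: s => //= -[u|p] s /=; case: (reduce s) => [|[v|p'] t] /= [h1 h2]; lia.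
Qed.

Lemma eqpre_letters w x y : eqpre L x y -> letters x w = letters y w.
Proof.
elim: w x y => //= o w IH x y h; rewrite (IH _ _ (eqpre_step o h)).
have hp : eqpre L (pre o x) (pre o y) by apply: eqpre_ract.
by rewrite (eqpre_zpre (leqnSn j) hp) (hp j).
Qed.

Definition vertex : finType := {dffun forall i : 'I_L, 'I_(d i)}.
Definition prefix x : vertex := finfun (fun i : 'I_L => x i).
(** The vertex is continued by zeros; the match on [idP] provides the proof of [k < L] needed to
    build the ordinal. *)
Definition ray (v : vertex) : X := fun k =>
  match idP : reflect (k < L) (k < L) with
  | ReflectT h => v (Ordinal h)
  | ReflectF _ => Ordinal (ltnW (hd2 k))
  end.

Lemma prefixP x y : reflect (eqpre L x y) (prefix x == prefix y).
Proof.
apply: (iffP eqP) => [h k kL|h].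
  by have := congr1 (fun v : vertex => v (Ordinal kL)) h; rewrite !ffunE.
by apply/ffunP => i; rewrite !ffunE h.
Qed.

Lemma rayK v : prefix (ray v) = v.
Proof.
apply/ffunP => -[k kL]; rewrite ffunE /ray /=.
by case: {-}_ / idP => // h; rewrite (bool_irrelevance h kL).
Qed.

Lemma ray_prefix x : eqpre L x (ray (prefix x)).
Proof. by apply/prefixP; rewrite rayK. Qed.

Lemma ray_inj v v' : eqpre L (ray v) (ray v') -> v = v'.
Proof. by move=> /prefixP; rewrite !rayK => /eqP. Qed.

Lemma card_vertex : #|vertex| = V d L.
Proof.
rewrite card_dep_ffun /V big_mkord foldrE big_map big_enum /=.
by apply: eq_bigr => i _; rewrite card_ord.
Qed.

(** An element is determined by its action on level [L] and its sections at the vertices of that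
    level, and equal reduced words give equal sections. *)
Lemma code_weq (w w' : seq Om) :
  (forall v, prefix (pos (ray v) w) = prefix (pos (ray v) w') /\
     reduce (letters (ray v) w) = reduce (letters (ray v) w')) ->
  weq (wprod hc w) (wprod hc w').
Proof.
move=> h x; have [-> ->] := wprodE w x; have [-> ->] := wprodE w' x.
have [hp hr] := h (prefix x).
have rx := ray_prefix x.
have [l1 t1] := section_valE w x; have [l2 t2] := section_valE w' x.
move: l1 t1 l2 t2; rewrite !(eqpre_letters _ rx).
have [<- <-] := reduce_val (letters (ray (prefix x)) w) (tail x).
have [<- <-] := reduce_val (letters (ray (prefix x)) w') (tail x).
rewrite hr => -> t1 -> t2; split=> //; apply: tail_inj; last by rewrite t1 t2.
move=> k kL; rewrite (eqpre_pos w rx kL) (eqpre_pos w' rx kL).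
by move/eqP/prefixP: hp; apply.
Qed.

End Level.
End Words.

Local Open Scope ring_scope.

(** * Lamps at last visits *)

Section Lamps.
Variables (K : realFieldType) (d : nat -> nat) (hd2 : forall j, (2 <= d j)%N).
Variables (F : finGroupType) (I : finType) (hc : I -> Hcoord d).
Arguments hc : clear implicits.
Variable invI : I -> I.
Hypothesis invIE : forall i l t, hc (invI i) l t = (hc i l t)^-1%g.
Hypothesis I_gt0 : (0 < #|I|)%N.
Local Notation X := (bnd d).
Local Notation Om := (Omega d I F).
Local Notation pre := (@pre_act d F I).
Local Notation post := (@post_act d F I hc).
Implicit Types (x y z : X) (w : seq Om).

Lemma hactK i x : hact (hc i) (hact (hc (invI i)) x) = x.
Proof.
rewrite -(@hact_mul _ (fun _ _ => 1%g)); last by move=> l t; rewrite invIE mulVg.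
by apply: bnd_ext => -[|m] //; rewrite hactS perm1 if_same.
Qed.

(** The step run backwards; it carries a prescribed lamp configuration past the first step in
    [ex_lamps_are]. *)
Definition back (o : Om) y : X :=
  ract o.1.1.1^-1 (hact (hc (invI o.1.1.2)) (ract o.2^-1 y)).

Lemma backK o y : post o (pre o (back o y)) = y.
Proof. by rewrite /post_act /pre_act /back !ractM mulVg ract1 hactK ractM mulVg ract1. Qed.

Definition strip (o : Om) := (o.1.1.1, o.1.1.2, o.2).

Lemma visits_strip L x w w' :
  map strip w = map strip w' -> visits hc L x w = visits hc L x w'.
Proof.
elim: w w' x => [|o w IH] [|o' w'] x //= [e1 e2 e3 e].
by rewrite /pre_act /post_act e1 e2 e3 (IH _ _ e).
Qed.

Lemma lamp_novisit L x w : visits hc L x w = 0%N -> lamp hc x w = 1%g.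
Proof.
elim: w x => //= o w IH x /eqP; rewrite addn_eq0 => /andP[z /eqP /IH ->].
rewrite mulg1 phi_f_nroot // => /is_root_zpre /(_ L) h.
by rewrite h in z.
Qed.

Lemma visits_eqpre L x y w : eqpre L x y -> visits hc L x w = visits hc L y w.
Proof.
elim: w x y => //= o w IH x y h; rewrite (IH _ _ (eqpre_step hc o h)).
by rewrite (@eqpre_zpre _ L L (pre o x) (pre o y)) //; apply: eqpre_ract.
Qed.

Variable j : nat.
Local Notation L := j.+1.
Local Notation vertex := (vertex d j).
Local Notation ray := (ray hd2 (j := j)).

Lemma av_lamps (G : Om -> K) :
  av G = av (fun s => av (fun i => av (fun s' => av (fun f => G (s, i, f, s'))))).
Proof.
rewrite !av_pair; apply: eq_av => s; apply: eq_av => i /=.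
exact: (av_exchange (fun f s' => G (s, i, f, s'))).
Qed.

Definition visited w : nat := \sum_(v : vertex) (0 < visits hc L (ray v) w)%N.

Definition zray : X := fun k => Ordinal (ltnW (hd2 k)).

(** The vertices are reindexed by their positions after the step. Only the vertex standing at 0^L
    can be newly counted, and only if it never returns; its prefix then agrees with that of
    [post o zray]. *)
Lemma visited_cons o w :
  (visited (o :: w) <= visited w + (visits hc L (post o zray) w == 0%N))%N.
Proof.
pose nxt (v : vertex) : vertex := prefix j (post o (pre o (ray v))).
have nxtE v : eqpre L (post o (pre o (ray v))) (ray (nxt v)) by apply: ray_prefix.
have nxt_inj : injective nxt.
  move=> v v' /eqP/prefixP h; apply: (ray_inj (hd2 := hd2)).
  exact: post_pre_inj_pre h.
rewrite {2}/visited (reindex_inj nxt_inj) /=.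
have zE v : zpre L (pre o (ray v)) -> eqpre L (post o (pre o (ray v))) (post o zray).
  move=> /zpreP zv; apply/eqpre_ract/eqpre_hact => k kL; apply: val_inj.
  by rewrite /= zv.
have [v0 zv0|nz] := pickP [pred v | zpre L (pre o (ray v))].
  rewrite /visited (bigD1 v0) //= [X in (_ <= X + _)%N](bigD1 v0) //=.
  rewrite addnAC leq_add //; last first.
    apply: leq_sum => v vv0; case: (boolP (zpre L _)) => zv /=.
      case/eqP: vv0; apply: (ray_inj (hd2 := hd2)).
      apply: (@post_pre_inj_pre _ _ _ hc _ o) => k kL.
      by rewrite (zE _ zv) // (zE _ zv0).
    by rewrite add0n (visits_eqpre _ (nxtE v)).
  rewrite -(visits_eqpre _ (nxtE v0)) (visits_eqpre _ (zE _ zv0)).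
  by case: visits => //= *; rewrite leq_b1.
rewrite (leq_trans _ (leq_addr _ _)) //; apply: leq_sum => v _ /=.
by have /= -> := nz v; rewrite add0n (visits_eqpre _ (nxtE v)).
Qed.

Definition lamps_are (Th : X -> F) w : bool := prop_b (forall x, lamp hc x w = Th x).

Lemma prop_bP P : reflect P (prop_b P).
Proof. by rewrite /prop_b; case: excluded_middle_informative => h; constructor. Qed.

(* Each lamp off the last visits is free, each last visit determines its lamp: this
   is the bound |F|^(n - visited) on the number of lamp sequences producing [Th],
   weighted by a function [psi] of the non-lamp part of the walk. *)
Lemma ex_lamps_are n (Th : X -> F) (psi : seq Om -> K) :
  (forall w, 0 <= psi w) ->
  (forall w w', map strip w = map strip w' -> psi w = psi w') ->
  ex n (fun w => (lamps_are Th w)%:R * #|F|%:R ^+ visited w * psi w) <= ex n psi.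
Proof.
have F1 : 1 <= #|F|%:R :> K by rewrite ler1n card_group_gt0.
elim: n Th psi => [|n IH] Th psi psi_ge0 psiE.
  have -> : ex 0 (fun w => (lamps_are Th w)%:R * #|F|%:R ^+ visited w * psi w) =
    (lamps_are Th [::])%:R * #|F|%:R ^+ visited [::] * psi [::] by [].
  rewrite [visited _]big1 // expr0 mulr1 ler_piMl //.
  by case: lamps_are.
rewrite [ex n.+1 _]/= [ex n.+1 psi]/= !av_lamps.
apply: av_le => s; apply: av_le => i; apply: av_le => s'.
pose o f : Om := (s, i, f, s').
(* [z] is where the root ray goes after the current lamp is used. [NR] says that it never comes back
   to 0^L; the current visit is then the last one and [fx] is the only lamp compatible with [Th]. *)
pose z := post (o 1%g) zray.
pose NR w := visits hc L z w == 0%N.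
pose fx := Th (ract s^-1 zray).
pose Th' f y := ((phi_f f (pre (o f) (back (o f) y)))^-1 * Th (back (o f) y))%g.
have ThE f w : lamps_are Th (o f :: w) -> lamps_are (Th' f) w.
  move=> /prop_bP h; apply/prop_bP => y; rewrite /Th' -h.
  by rewrite [lamp _ _ (_ :: _)]/= backK mulKg.
have fxE f w : lamps_are Th (o f :: w) -> NR w -> f = fx.
  move=> /prop_bP h /eqP nr; rewrite /fx -h [lamp _ _ (_ :: _)]/=.
  rewrite {1 2}/pre_act /= ractM mulVg ract1.
  by rewrite (lamp_novisit nr) mulg1 phi_f_root.
pose psi0 w := psi (o 1%g :: w).
have psi0E f w : psi (o f :: w) = psi0 w by apply: psiE.
(* [NR] ignores the lamps, so the induction hypothesis applies to both halves of the weight. *)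
pose psia w := (~~ NR w)%:R * psi0 w.
pose psib w := (NR w)%:R * psi0 w.
have NRs w w' : map strip w = map strip w' -> NR w = NR w'.
  by move=> e; rewrite /NR (visits_strip _ _ e).
have psi0s w w' : map strip w = map strip w' -> psi0 w = psi0 w'.
  by move=> e; apply: psiE; rewrite /= e.
have bound f w :
  (lamps_are Th (o f :: w))%:R * #|F|%:R ^+ visited (o f :: w) * psi (o f :: w) <=
  (lamps_are (Th' f) w)%:R * #|F|%:R ^+ visited w * psia w +
  ((f == fx)%:R * #|F|%:R) *
    ((lamps_are (Th' fx) w)%:R * #|F|%:R ^+ visited w * psib w).
  have p0 : 0 <= psi0 w by apply: psi_ge0.
  have FN m : 0 <= #|F|%:R ^+ m :> K by rewrite exprn_ge0 ?ler0n.
  have vc := visited_cons (o f) w; rewrite -/z in vc.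
  rewrite psi0E; case: (boolP (lamps_are Th _)) => [h|_]; last first.
    by rewrite !mul0r addr_ge0 ?mulr_ge0 ?ler0n.
  rewrite /psia /psib; case: (boolP (NR w)) => nr.
    have <- := fxE _ _ h nr; rewrite eqxx (ThE _ _ h) !mul1r mul0r mulr0 add0r.
    rewrite mulrA -exprS ler_wpM2r // ler_weXn2l //.
    by move: vc nr; rewrite /NR /z => + e; rewrite e addn1.
  rewrite (ThE _ _ h) !mul1r mul0r !mulr0 addr0 ler_wpM2r // ler_weXn2l //.
  by move: vc nr; rewrite /NR /z => + /negbTE e; rewrite e addn0.
(* On a last visit the extra factor |F| is cancelled exactly by the probability 1/|F| of the forced
   lamp. *)
have FF : av (fun f : F => (f == fx)%:R * #|F|%:R) = 1 :> K.
  rewrite avZr /av (bigD1 fx) //= eqxx big1 ?addr0; last by move=> f /negbTE ->.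
  by rewrite mul1r mulVf //; have : 0 < #|F|%:R :> K; lra.
apply: (le_trans (av_le (fun f => ex_le (fun w _ => bound f w)))).
apply: (@le_trans _ _ (av (fun f : F => ex n psia + (f == fx)%:R * #|F|%:R * ex n psib))).
  apply: av_le => f; rewrite exD exZ lerD //.
    apply: IH => [w|w w' e]; first by rewrite mulr_ge0 ?ler0n // psi_ge0.
    by rewrite /psia (NRs _ _ e) (psi0s _ _ e).
  apply: ler_wpM2l; first by rewrite mulr_ge0 ?ler0n.
  apply: IH => [w|w w' e]; first by rewrite mulr_ge0 ?ler0n // psi_ge0.
  by rewrite /psib (NRs _ _ e) (psi0s _ _ e).
rewrite avD avZr FF mul1r av_cst ?card_group_gt0 // -exD.
rewrite -[X in X <= _](av_cst _ (card_group_gt0 F)); apply: av_le => f.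
apply: ex_le => w _; rewrite psi0E /psia /psib -mulrDl.
by case: (NR w); rewrite /= ?add0r ?addr0 mul1r.
Qed.

Hypothesis hc_unif : forall l (t : 'I_(d l)), (0 < nat_of_ord t)%N ->
      forall p : {perm 'I_(d l.+1)},
        (#|[set i | hc i l t == p]| * #|{perm 'I_(d l.+1)}| = #|I|)%N.

(** A bound on [tau L] uniform in the ray, with every [ud] replaced by 1. *)
Definition maxtau : K := \sum_(i < L) (V d i.+1)%:R / q K d i.

(** Markov's inequality: a vertex that misses 0^L has truncated hitting time [n], whose mean is at
    most [maxtau]. Summing over the vertices gives the factor V_L. *)
Lemma ex_visited n :
  n%:R * ((V d L)%:R - ex n (fun w => (visited w)%:R)) <= (V d L)%:R * maxtau.
Proof.
have O0 := card_Om_gt0 d F I_gt0.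
rewrite -card_vertex -sum1_card natr_sum.
have -> : ex n (fun w => (visited w)%:R) =
    \sum_(v : vertex) ex n (fun w => (0 < visits hc L (ray v) w)%N%:R) :> K.
  rewrite -ex_sum; apply: eq_ex => w _; exact: natr_sum.
rewrite -sumrB mulr_sumr mulr_suml; apply: ler_sum => v _; rewrite mul1r.
have -> : 1 - ex n (fun w => (0 < visits hc L (ray v) w)%N%:R) =
    ex n (fun w => (visits hc L (ray v) w == 0%N)%:R) :> K.
  rewrite -[X in X - _](ex_cst n _ O0); apply/eqP; rewrite subr_eq -exD.
  by apply/eqP/eq_ex => w _; case: (visits _ _ _ _) => /=; rewrite ?addr0 ?add0r.
rewrite -exZ; apply: le_trans (_ : @A K d (@tau K d L) (ray v) <= _).
  have eh := ex_hit K hd2 F I_gt0 hc_unif n L (ray v).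
  apply: le_trans eh.
  apply: ex_le => w sw; case: eqP => [/hit_novisit ->|_]; first by rewrite sw mulr1.
  by rewrite mulr0 ler0n.
rewrite -[maxtau](A_cst maxtau (ray v)); apply: A_le => y; apply: ler_sum => i _.
rewrite ler_piMr ?divr_ge0 ?ler0n ?(ltW (q_gt0 _ hd2 _)) //.
by case/andP: (ud_ge0le1 K hd2 i y).
Qed.

End Lamps.

Bind Scope ring_scope with R.
Local Arguments exp x%_ring_scope.
Local Arguments ln x%_ring_scope.

(** * Entropy *)

Lemma exp_gt0 (x : R) : 0 < exp x.
Proof. exact/RltP/exp_pos. Qed.

Lemma exp_ge1D (x : R) : 1 + x <= exp x.
Proof. exact/RleP/exp_ineq1_le. Qed.

Lemma expK (x : R) : 0 < x -> exp (ln x) = x.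
Proof. by move=> /RltP; apply: exp_ln. Qed.

Lemma expN (x : R) : exp (- x) = (exp x)^-1.
Proof. by rewrite -RinvE -exp_Ropp. Qed.

Lemma exp_sum (J : finType) (f : J -> R) : exp (\sum_j f j) = \prod_j exp (f j).
Proof. by apply: (big_morph exp) => [x y|]; rewrite ?expRD ?expR0. Qed.

Lemma exp_muln (x : R) n : exp (n%:R * x) = exp x ^+ n.
Proof. by rewrite expRX mulr_natl. Qed.

Lemma ln_le_gibbs (a l : R) : 0 < a -> ln a <= l + (a / exp l - 1).
Proof.
move=> a0; have := exp_ge1D (ln a - l); rewrite -expRD expN expK // => h; lra.
Qed.

Lemma ln_ge_gibbs (a b : R) : 0 < a -> b + (1 - exp b / a) <= ln a.
Proof.
move=> a0; have := exp_ge1D (b - ln a); rewrite -expRD expN expK // => h; lra.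
Qed.

(** Apply [ln_le_gibbs] pointwise with l the code length. The error averages to at most the Kraft
    sum minus 1, because 1 / (fibre size) adds up to at most 1 over each fibre of the code. *)
Lemma gibbs_upper (T C : finType) (c : T -> C) (cnt : T -> nat) (len : C -> R) :
  (forall w, #|[set w' | c w' == c w]| <= cnt w)%N -> (0 < #|T|)%N ->
  \sum_(e : C) (exp (len e))^-1 <= 1 ->
  av (fun w => ln (#|T|%:R / (cnt w)%:R)) <= av (fun w => len (c w)).
Proof.
move=> hcnt T0 kraft.
have m0 w : (0 < #|[set w' | c w' == c w]|)%N.
  by apply/card_gt0P; exists w; rewrite inE.
have N0 : 0 < #|T|%:R :> R by rewrite ltr0n.
apply: (le_trans (av_le (fun w => ln_le_gibbs (len (c w))
  (divr_gt0 N0 (_ : 0 < (cnt w)%:R))))) => [w|].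
  by rewrite ltr0n (leq_trans (m0 w)).
rewrite avD gerDl avB av_cst // subr_le0; apply: le_trans kraft.
apply: le_trans (_ : \sum_w (#|[set w' | c w' == c w]|%:R * exp (len (c w)))^-1 <= _).
  rewrite /av mulr_suml; apply: ler_sum => w _.
  have c0 : 0 < (cnt w)%:R :> R by rewrite ltr0n (leq_trans (m0 w)).
  have e0 := exp_gt0 (len (c w)).
  have -> : #|T|%:R / (cnt w)%:R / exp (len (c w)) / #|T|%:R =
     ((cnt w)%:R * exp (len (c w)))^-1 :> R by field; rewrite !lt0r_neq0.
  rewrite lef_pV2; [|by rewrite posrE mulr_gt0|by rewrite posrE mulr_gt0 // ltr0n].
  by apply: ler_wpM2r; [apply: ltW | rewrite ler_nat].
rewrite (partition_big c predT) //=; apply: ler_sum => e _.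
under eq_bigr => w /eqP -> do [].
rewrite sumr_const -[_ *+ _]mulr_natr.
rewrite -(cardsE (fun w => c w == e)); set m := #|_|.
have [->|] := eqVneq m 0%N.
  by rewrite mulr0 invr_ge0 ltW // exp_gt0.
rewrite -lt0n -(ltr0n R) => h; have e0 := exp_gt0 (len e).
by rewrite invfM mulrAC mulVf ?mul1r // lt0r_neq0.
Qed.

(** The |T|^k words of length k have total weight 2^-k. *)
Lemma kraft_bseq (T : finType) n : (0 < #|T|)%N ->
  \sum_(s : n.-bseq T) ((2 * #|T|%:R) ^+ size s)^-1 <= 2 :> R.
Proof.
move=> T0; have T0' : #|T|%:R != 0 :> R by rewrite pnatr_eq0 -lt0n.
rewrite (reindex (@tagged_tuple_bseq n T)) /=; last exact: onW_bij.
rewrite -(sig_big_dep xpredT (fun _ => xpredT)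
  (fun (k : 'I_n.+1) (t : k.-tuple T) => ((2 * #|T|%:R) ^+ size t)^-1)) /=.
rewrite (eq_bigr (fun k : 'I_n.+1 => (2 ^+ k)^-1)); last first.
  move=> k _; rewrite (eq_bigr (fun=> ((2 * #|T|%:R) ^+ k)^-1)); last first.
    by move=> t _; rewrite size_tuple.
  rewrite sumr_const card_tuple -[_ *+ _]mulr_natr exprMn natrX.
  by field; rewrite !expf_neq0 // pnatr_eq0.
suff -> : \sum_(k < n.+1) (2 ^+ k)^-1 = 2 - (2 ^+ n)^-1 :> R.
  by rewrite gerBl invr_ge0 exprn_ge0.
elim: n => [|n IH]; first by rewrite big_ord1 expr0; lra.
by rewrite big_ord_recr /= IH exprS; field; rewrite expf_neq0 // pnatr_eq0.
Qed.

Section Entropy.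
Variables (d : nat -> nat) (hd2 : forall j, (2 <= d j)%N).
Variables (F : finGroupType) (I : finType) (hc : I -> Hcoord d).
Arguments hc : clear implicits.
Variables (mulI : I -> I -> I) (invI : I -> I).
Hypothesis mulIE : forall i j l t, hc (mulI i j) l t = (hc i l t * hc j l t)%g.
Hypothesis invIE : forall i l t, hc (invI i) l t = (hc i l t)^-1%g.
Hypothesis I_gt0 : (0 < #|I|)%N.
Hypothesis hc_unif : forall l (t : 'I_(d l)), (0 < nat_of_ord t)%N ->
      forall p : {perm 'I_(d l.+1)},
        (#|[set i | hc i l t == p]| * #|{perm 'I_(d l.+1)}| = #|I|)%N.
Local Notation Om := (Omega d I F).

Lemma entropyE n : entropy F hc n =
  av (fun w : n.-tuple Om => ln (#|{: n.-tuple Om}|%:R / (count_same hc w)%:R)).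
Proof.
rewrite /entropy INRE card_tuple.
have foldrE (s : seq R) : foldr Rplus R0 s = \sum_(x <- s) x.
  by elim: s => [|x s IH] /=; rewrite ?big_nil // big_cons IH.
rewrite foldrE big_map /av mulr_suml card_tuple big_enum_cond /=.
by apply: eq_big => w; rewrite ?inE // => _; rewrite INRE RdivE RmultE RinvE mulrC.
Qed.

Lemma tuple_gt0 n : (0 < #|{: n.-tuple Om}|)%N.
Proof. by rewrite card_tuple expn_gt0 (card_Om_gt0 d F I_gt0). Qed.

Lemma ex_av n (G : seq Om -> R) : ex n G = av (fun w : n.-tuple Om => G w).
Proof. by rewrite ex_tuple /av card_tuple. Qed.

Lemma count_same_gt0 n (w : n.-tuple Om) : (0 < count_same hc w)%N.
Proof. by apply/card_gt0P; exists w; rewrite inE; apply/prop_bP. Qed.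

(** Gibbs' inequality with weight |F|^visited: the error term is nonnegative because [ex_lamps_are],
    used with [psi] = 1, bounds the mean weight of the words having the lamps of a given [w']. *)
Lemma entropy_ge j n : (1 < #|F|)%N ->
  ln #|F|%:R * ex n (fun w : seq Om => (visited hd2 hc j w)%:R) <= entropy F hc n.
Proof.
move=> hF; rewrite -exZ ex_av entropyE.
set N : R := #|{: n.-tuple Om}|%:R; have N0 : 0 < N by rewrite ltr0n tuple_gt0.
have F0 : 0 < #|F|%:R :> R by rewrite ltr0n ltnW.
have c0 (w : n.-tuple Om) : 0 < (count_same hc w)%:R :> R by rewrite ltr0n count_same_gt0.
pose b (w : n.-tuple Om) := ln #|F|%:R * (visited hd2 hc j w)%:R.
apply: le_trans (_ : av b + (1 - av (fun w => exp (b w) / (N / (count_same hc w)%:R))) <= _);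
  last first.
  rewrite -[X in _ + (X - _)](av_cst _ (tuple_gt0 n)) -avB -avD.
  by apply: av_le => w; apply: ln_ge_gibbs; apply: divr_gt0.
rewrite lerDl subr_ge0.
have expb w : exp (b w) = #|F|%:R ^+ visited hd2 hc j w.
  by rewrite /b mulrC exp_muln expK.
(* The ratio [count_same] / N is an average over a second word [w']; after the exchange [w'] is
   fixed and [w] varies. *)
have -> : av (fun w => exp (b w) / (N / (count_same hc w)%:R)) =
   av (fun w' : n.-tuple Om => av (fun w : n.-tuple Om =>
     (prop_b (weq (wprod hc w') (wprod hc w)))%:R * #|F|%:R ^+ visited hd2 hc j w)).
  rewrite -av_exchange; apply: eq_av => w; rewrite avZr expb.
  rewrite invfM invrK mulrC; congr (_ * _).
  rewrite /av mulrC -/N; congr (_ / _); rewrite /count_same -sum1_card natr_sum big_mkcond /=.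
  by apply: eq_bigr => w' _; rewrite inE; case: prop_b.
rewrite -[X in _ <= X](av_cst _ (tuple_gt0 n)); apply: av_le => w'.
rewrite -[X in _ <= X](ex_cst n _ (card_Om_gt0 d F I_gt0)).
have psiE (w1 w2 : seq Om) : map (@strip d F I) w1 = map (@strip d F I) w2 -> 1 = 1 :> R by [].
have := @ex_lamps_are R d hd2 F I hc invI invIE j n (fun x => lamp hc x w') _
  (fun=> ler01) psiE.
move=> h; apply: (le_trans _ h); rewrite ex_av.
apply: av_le => w.
rewrite mulr1 ler_wpM2r //.
  by rewrite exprn_ge0 // ltW.
rewrite ler_nat; case: prop_bP => // hw.
suff -> : lamps_are hc ((lamp hc)^~ w') w by [].
apply/prop_bP => x.
by have [<- _] := wprodE hc w x; have [<- _] := wprodE hc w' x; have [-> _] := hw x.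
Qed.

Lemma size_letters j x (w : seq Om) : (size (letters hc j x w) <= size w)%N.
Proof.
elim: w x => //= o w IH x; have h := IH (post_act hc o (pre_act o x)).
by case: ifP => _; first case: ifP => _ /=; rewrite ?ltnS // (leq_trans h).
Qed.

Section Code.
Variables j n : nat.
Local Notation L := j.+1.
Local Notation letter := (@letter d F I j).
Local Notation vertex := (vertex d j).

Lemma size_reduce_le (s : seq letter) : (size (reduce mulI s) <= size s)%N.
Proof.
elim: s => //= a s IH; rewrite /push.
by case: a (reduce _ s) IH => [u|p] [|[v|p'] t] //= h; rewrite ltnW.
Qed.

Definition red x (w : seq Om) : seq letter := reduce mulI (letters hc j x w).

(** Sum [size_reduce] and [ex_exits] over the vertices with no passage pending at the start; by
    [sum_visits] the visits add up to at most [n]. *)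
Lemma ex_size_red : ex n (fun w : seq Om => \sum_(v : vertex) (size (red (ray hd2 v) w))%:R) <=
  2 * (V d L)%:R + 2 * (q R d L * n%:R) :> R.
Proof.
have O0 := card_Om_gt0 d F I_gt0.
apply: le_trans (_ : ex n (fun w : seq Om => 2 * (V d L)%:R +
   2 * \sum_(v : vertex) (exits hc j (ray hd2 v) false w)%:R) <= _).
  apply: ex_le => w _; rewrite -card_vertex -sum1_card natr_sum !mulr_sumr -big_split /=.
  apply: ler_sum => v _; rewrite mulr1 -alternations_letters.
  apply: le_trans (_ : ((alternations false (letters hc j (ray hd2 v) w)).*2 + 2)%N%:R <= _).
    by rewrite ler_nat size_reduce.
  by rewrite natrD -muln2 natrM; lra.
rewrite exD ex_cst // lerD2l exZ ex_sum ler_pM2l //.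
apply: le_trans (_ : \sum_(v : vertex) q R d L *
    ex n (fun w : seq Om => (visits hc L (ray hd2 v) w)%:R) <= _).
  apply: ler_sum => v _.
  by have := ex_exits R hd2 F I_gt0 hc_unif n j (ray hd2 v) false; rewrite mul0r add0r.
rewrite -mulr_sumr ler_pM2l ?q_gt0 // -ex_sum -[n%:R](ex_cst n _ O0).
apply: ex_le => w sw; rewrite -natr_sum ler_nat -sw.
by apply: sum_visits => v v'; apply: ray_inj.
Qed.

(** A word is coded by the image and the reduced section word of every vertex. An image costs ln
    (2N) rather than ln N so as to absorb the bound 2 of [kraft_bseq]; each letter costs ln M. *)
Lemma entropy_le (N := (V d L)%:R : R) (M := (2 * #|letter|%:R) : R) :
  entropy F hc n <= N * ln (2 * N) + ln M * (2 * N + 2 * (q R d L * n%:R)).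
Proof.
rewrite entropyE.
have N1 : 1 <= N by rewrite ler1n V_gt0.
have K0 : (0 < #|letter|)%N by rewrite card_sum addn_gt0 card_perm_gt0 orbT.
have M1 : 1 <= M.
  by have : 1 <= #|letter|%:R :> R; [rewrite ler1n | rewrite /M; lra].
have lnM0 : 0 <= ln M.
  have M0 := lt_le_trans ltr01 M1.
  apply: le_trans (ln_ge_gibbs 0 M0); rewrite expR0 add0r subr_ge0 mul1r.
  by rewrite invf_le1.
pose C : finType := {ffun vertex -> vertex * n.-bseq letter}.
pose code (w : n.-tuple Om) : C := [ffun v => (prefix j (pos hc (ray hd2 v) w),
   insub_bseq n (red (ray hd2 v) w))].
(* Reduced words fit in length [n], so [insub_bseq] stores them faithfully instead of returning its
   default. *)
have redn (v : vertex) (w : n.-tuple Om) : (size (red (ray hd2 v) w) <= n)%N.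
  by rewrite (leq_trans (size_reduce_le _)) // (leq_trans (size_letters _ _ _)) // size_tuple.
have codeE (v : vertex) (w : n.-tuple Om) : code w v = (prefix j (pos hc (ray hd2 v) w), insub_bseq n (red (ray hd2 v) w)).
  by rewrite ffunE.
have insubE (v : vertex) (w : n.-tuple Om) : insub_bseq n (red (ray hd2 v) w) = red (ray hd2 v) w :> seq _.
  by rewrite [LHS]val_insubd redn.
pose len (e : C) : R := \sum_v (ln (2 * N) + (size (e v).2)%:R * ln M).
apply: le_trans (gibbs_upper (c := code) (len := len) _ (tuple_gt0 n) _) _.
- move=> w; apply: subset_leq_card; apply/subsetP => w'; rewrite !inE => /eqP e.
  apply/prop_bP; apply: (code_weq (hd2 := hd2) mulIE (j := j)) => v.
  have := congr1 (fun c : C => c v) e; rewrite !codeE => -[-> e2]; split=> //.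
  by rewrite -[LHS](insubE v) e2 insubE.
- have -> : \sum_(e : C) (exp (len e))^-1 =
     \sum_(e : C) \prod_v ((2 * N)^-1 * (M ^+ size (e v).2)^-1).
    apply: eq_bigr => e _; rewrite /len exp_sum -prodfV; apply: eq_bigr => v _.
    rewrite -expRD exp_muln !expK; [by rewrite invfM | exact: lt_le_trans M1 | lra].
  (* The Kraft sum factors over the vertices, and each factor is at most 1. *)
  rewrite -(bigA_distr_bigA (fun (v : vertex) (p : vertex * n.-bseq letter) =>
     (2 * N)^-1 * (M ^+ size p.2)^-1)).
  rewrite big_const iter_mulr_1.
  have inner : \sum_(p : vertex * n.-bseq letter) (2 * N)^-1 * (M ^+ size p.2)^-1 <= 1.
    rewrite -mulr_sumr -(pair_bigA _ (fun (v : vertex) (s : n.-bseq letter) => (M ^+ size s)^-1)) /=.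
    rewrite sumr_const -[X in _ * X]mulr_natr card_vertex -/N.
    have h := kraft_bseq n K0; rewrite -/M in h.
    have -> : forall S : R, (2 * N)^-1 * (S * N) = S / 2 by move=> S; field; lra.
    lra.
  apply: exprn_ile1 => //; apply: sumr_ge0 => p _.
  by rewrite mulr_ge0 ?invr_ge0 ?exprn_ge0 //; lra.
apply: le_trans (_ : N * ln (2 * N) +
   ln M * ex n (fun w : seq Om => \sum_(v : vertex) (size (red (ray hd2 v) w))%:R) <= _).
  rewrite ex_av -avZ -[X in _ <= X + _](av_cst _ (tuple_gt0 n)) -avD.
  apply: av_le => w; rewrite /len big_split /= sumr_const -[X in X + _]mulr_natl.
  rewrite card_vertex mulr_sumr lerD2l; apply: ler_sum => v _.
  by rewrite codeE /= insubE mulrC.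
by rewrite lerD2l; apply: ler_wpM2l => //; apply: ex_size_red.
Qed.

End Code.
End Entropy.

(** * Asymptotics *)

Lemma lnM (x y : R) : 0 < x -> 0 < y -> ln (x * y) = ln x + ln y.
Proof. by move=> /RltP x0 /RltP y0; rewrite -RmultE ln_mult. Qed.

Lemma ler_ln (x y : R) : 0 < x -> x <= y -> ln x <= ln y.
Proof.
move=> /RltP x0; rewrite le_eqVlt => /predU1P[->//|/RltP xy].
exact/ltW/RltP/ln_increasing.
Qed.

Lemma ln_expr (x : R) n : 0 < x -> ln (x ^+ n) = n%:R * ln x.
Proof.
move=> x0; elim: n => [|n IH]; first by rewrite expr0 mul0r ln_1.
by rewrite exprS lnM ?exprn_gt0 // IH -natr1; ring.
Qed.

(** Makes ln l smaller than any multiple of l, up to a constant. *)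
Lemma ln_div_le (delta x : R) : 0 < delta -> 0 < x -> ln x <= delta * x - ln delta.
Proof.
move=> d0 x0; have := ln_le_gibbs 0 (mulr_gt0 d0 x0).
rewrite expR0 divr1 lnM // => h; lra.
Qed.

(** * Growth of V_i / q_i and the cutoff level k(n) *)

Section Exponents.
Variables (d : nat -> nat) (hd2 : forall j, (2 <= d j)%N) (D : nat).
Hypothesis hD : forall j, (d j <= D)%N.

Lemma pcoefE j : pcoef d j = r R d j / (d j)%:R.
Proof.
rewrite /pcoef RdivE RminusE RpowE INRE /r -[R1]/(1 : R).
by field; rewrite pnatr_eq0 -lt0n ltnW.
Qed.

Lemma pprodE k : pprod d k = q R d k.+1 / (V d k.+1)%:R.
Proof.
elim: k => [|k IH]; rewrite /= ?RmultE pcoefE.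
  by rewrite /V big_nat1 mul1r.
by rewrite IH [V d k.+2]VS natrM invfM mulrACA.
Qed.

(** Amounts to (d_j - 2)^2 >= 0, and yields the growth rate 4 in [WS]. *)
Lemma pcoef_le j : 4 * (r R d j / (d j)%:R) <= 1.
Proof.
have h : 1 < (d j)%:R :> R := d_gt1 R hd2 j.
rewrite /r mulrA ler_pdivrMr ?mul1r; last lra.
have := sqr_ge0 ((d j)%:R - 2 : R); rewrite expr2 => h2.
by rewrite mulrA ler_pdivrMr; lra.
Qed.

(** The inverse of p_0 ... p_(i-1), so k(n) is the index at which [W] passes n. *)
Definition W i : R := (V d i)%:R / q R d i.

Lemma W_gt0 i : 0 < W i.
Proof. by rewrite divr_gt0 ?q_gt0 // ltr0n V_gt0. Qed.

Lemma WS i : 4 * W i <= W i.+1.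
Proof.
have d0 : 1 < (d i)%:R :> R := d_gt1 R hd2 i.
have r0 := r_gt0 R hd2 i; have q0 := q_gt0 R hd2 i; have w0 := W_gt0 i.
have -> : W i = W i.+1 * (r R d i / (d i)%:R).
  rewrite /W VS natrM [q R d i.+1]/=.
  have E (a b c e : R) : 0 < b -> 0 < c -> 0 < e -> a / b = a * e / (b * c) * (c / e).
    by move=> b0 c0 e0; field; rewrite !lt0r_neq0.
  by apply: E => //; apply: lt_trans d0.
have w1 := W_gt0 i.+1; have := pcoef_le i; nra.
Qed.

Lemma W_exp i m : 4 ^+ m * W i <= W (i + m).
Proof.
elim: m => [|m IH]; first by rewrite expr0 mul1r addn0.
rewrite addnS exprS; have := WS (i + m); lra.
Qed.

(** Each term is d_i W_i <= D W_i, and since W grows at least geometrically the last term dominates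
    the sum. *)
Lemma maxtau_le j : maxtau R d j <= 2 * D%:R * W j.
Proof.
have D0 : 0 <= D%:R :> R by rewrite ler0n.
have term i : (V d i.+1)%:R / q R d i <= D%:R * W i.
  rewrite VS natrM /W mulrC mulrA [_^-1 * _]mulrC mulrC; apply: ler_wpM2r.
    exact: ltW (W_gt0 i).
  by rewrite ler_nat.
rewrite /maxtau; elim: j => [|j IH].
  rewrite big_ord1; apply: le_trans (term 0%N) _.
  by have := W_gt0 0; nra.
rewrite big_ord_recr; apply: le_trans (lerD IH (term j.+1)) _.
have t2 := ler_wpM2l D0 (WS j); have t3 := mulr_ge0 D0 (ltW (W_gt0 j)); lra.
Qed.

Lemma ksearchP n f k0 : let k := ksearch d n f k0 in
  [/\ (k <= k0 + f)%N, (k < k0 + f)%N -> pprod d k * n%:R <= 1 &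
      forall m, (k0 <= m < k)%N -> 1 < pprod d m * n%:R].
Proof.
elim: f k0 => [|f IH] k0 /=.
  by rewrite addn0 ltnn; split=> // m /andP[a b]; have := leq_ltn_trans a b; rewrite ltnn.
case: Rle_dec => /=; rewrite RmultE INRE => h.
  split=> [|_|m /andP[a b]]; first exact: leq_addr.
    exact/RleP.
  by have := leq_ltn_trans a b; rewrite ltnn.
have [h1 h2 h3] := IH k0.+1; rewrite addSnnS in h1 h2.
split=> // m /andP[]; rewrite leq_eqVlt => /predU1P[<- _|a b]; last by apply: h3; rewrite a.
by rewrite ltNge; apply/negP => /RleP.
Qed.

Lemma pprodV k : pprod d k = (W k.+1)^-1.
Proof. by rewrite pprodE /W invf_div. Qed.

Lemma W0 : W 0 = 1.
Proof. by rewrite /W /V big_geq // divr1. Qed.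

Lemma kfunP n : (0 < n)%N -> n%:R <= W (kfun d n).+1 /\ W (kfun d n) <= n%:R.
Proof.
move=> n0; have [] := ksearchP n n.+1 0; rewrite -/(kfun d n) add0n.
set k := kfun d n => kn h1 h2.
have Wlt m : (m < k)%N -> W m.+1 < n%:R.
  move=> mk; have := h2 m mk; rewrite pprodV mulrC => h.
  by rewrite -(mul1r (W _)) -ltr_pdivlMr ?W_gt0.
split; last first.
  case: (k) Wlt => [|m] Wlt; first by rewrite W0 ler1n.
  exact/ltW/Wlt.
have [kn'|] := ltnP k n.+1.
  have := h1 kn'; rewrite pprodV mulrC => h.
  by rewrite -[W _]mul1r -ler_pdivrMr ?W_gt0.
(* The fuel cannot run out: that would give 4^(n+1) <= W_(n+1) < n. *)
move=> nk; have := Wlt n nk; have := W_exp 0 n.+1; rewrite add0n W0 mulr1 => a b.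
have c : (n <= 4 ^ n.+1)%N by apply: leq_trans (ltnW (ltn_expl n (isT : 1 < 4)%N)) _; rewrite leq_exp2l.
have {}c : n%:R <= 4 ^+ n.+1 :> R by rewrite -natrX ler_nat.
lra.
Qed.

Lemma V_le i m : (V d (i + m) <= V d i * D ^ m)%N.
Proof.
elim: m => [|m IH]; first by rewrite addn0 muln1.
by rewrite addnS VS expnSr mulnA leq_mul.
Qed.

Lemma kfun_ln n : (0 < n)%N -> (kfun d n)%:R <= 2 * ln n%:R.
Proof.
move=> n0; have [_ h] := kfunP n0; set k := kfun d n in h *.
have := W_exp 0 k; rewrite add0n W0 mulr1 => a.
have b : 2 ^+ k <= n%:R :> R.
  by apply: le_trans h; apply: le_trans a; apply: lerXn2r; rewrite ?nnegrE; lra.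
have := ler_ln _ b; rewrite ln_expr //.
have l2 : 1 / 2 < ln 2.
  have E : IZR 2 = 2 :> R by rewrite IZRposE INRE.
  by have /RltP := ln_lt_2; rewrite E RinvE mul1r.
have k0 : 0 <= k%:R :> R by rewrite ler0n.
move=> /(_ (exprn_gt0 _ _)) c; have : k%:R * ln 2 <= ln n%:R by apply: c; lra.
nra.
Qed.

End Exponents.

(** * The entropy compared with V_(k(n)+1) *)

Section Main.
Variables (d : nat -> nat) (hd2 : forall j, (2 <= d j)%N) (D : nat).
Hypothesis hD : forall j, (d j <= D)%N.
Variables (F : finGroupType) (I : finType) (hc : I -> Hcoord d).
Arguments hc : clear implicits.
Variables (mulI : I -> I -> I) (invI : I -> I).
Hypothesis mulIE : forall i j l t, hc (mulI i j) l t = (hc i l t * hc j l t)%g.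
Hypothesis invIE : forall i l t, hc (invI i) l t = (hc i l t)^-1%g.
Hypothesis I_gt0 : (0 < #|I|)%N.
Hypothesis hc_unif : forall l (t : 'I_(d l)), (0 < nat_of_ord t)%N ->
      forall p : {perm 'I_(d l.+1)},
        (#|[set i | hc i l t == p]| * #|{perm 'I_(d l.+1)}| = #|I|)%N.
Local Notation Vk n := ((V d (kfun d n).+1)%:R : R).

Lemma Vk_ge1 n : 1 <= Vk n.
Proof. by rewrite ler1n V_gt0. Qed.

Lemma ln_F_gt0 : (1 < #|F|)%N -> 0 < ln #|F|%:R.
Proof.
move=> hF; have F0 : 0 < #|F|%:R :> R by rewrite ltr0n ltnW.
apply: lt_le_trans (ln_ge_gibbs 0 F0); rewrite expR0 mul1r add0r subr_gt0.
by rewrite invf_lt1 // ltr1n.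
Qed.

Lemma half_le (n v e t : R) :
  0 < n -> 0 <= v -> 2 * t <= n -> n * (v - e) <= v * t -> v / 2 <= e.
Proof.
move=> n0 v0 tn h; have h1 : v * (2 * t) <= v * n by apply: ler_wpM2l.
have : n * (v - e) <= n * (v / 2) by lra.
by rewrite ler_pM2l //; lra.
Qed.

Lemma entropy_lower : (1 < #|F|)%N -> exists2 c : R, 0 < c &
  forall n, (4 * D <= n)%N -> c * Vk n <= entropy F hc n.
Proof.
move=> hF; have lF := ln_F_gt0 hF.
have D2 : (2 <= D)%N by apply: leq_trans (hd2 0) (hD 0).
have D0 : 0 < D%:R :> R by rewrite ltr0n (leq_trans _ D2).
have E0 : 0 < D%:R ^+ D :> R by rewrite exprn_gt0.
exists (ln #|F|%:R / 2 / D%:R ^+ D); first by rewrite !divr_gt0.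
(* Going up D levels from k divides W by at least 4^D >= 4D, which makes 2 [maxtau] <= n, while V
   shrinks by at most D^D. If k <= D then j = 0 and W_0 = 1, and the assumption 4D <= n is what is
   needed. *)
move=> n nD; set k := kfun d n; pose j := (k - D)%N.
have n0 : (0 < n)%N by apply: leq_trans nD; rewrite muln_gt0 /= (leq_trans _ D2).
have nR : 0 < n%:R :> R by rewrite ltr0n.
have nDR : 4 * D%:R <= n%:R :> R by rewrite -natrM ler_nat.
have [_ Wk] := kfunP hd2 n0; rewrite -/k in Wk.
have tau_le : 2 * maxtau R d j <= n%:R.
  have := maxtau_le hd2 hD j; have [kD|Dk] := leqP k D.
    by rewrite {2}/j (eqP kD) W0 => h; lra.
  have := W_exp hd2 j D; rewrite /j subnK ?(ltnW Dk) // -/j => h1 h2.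
  have h3 : D%:R <= 4 ^+ D.-1 :> R.
    rewrite -natrX ler_nat.
    by have := ltn_expl D.-1 (isT : 1 < 4)%N; rewrite prednK // (leq_trans _ D2).
  have h4 : 4 * D%:R <= 4 ^+ D :> R.
    by rewrite -[X in _ ^+ X]prednK ?(leq_trans _ D2) // exprS; lra.
  have := ler_wpM2r (ltW (W_gt0 hd2 j)) h4; lra.
have Vj1 : 1 <= (V d j.+1)%:R :> R by rewrite ler1n V_gt0.
have vis := ex_visited R hd2 F I_gt0 j hc_unif n.
set ev := ex n _ in vis.
have ev_ge : (V d j.+1)%:R / 2 <= ev := half_le nR (ler0n _ _) tau_le vis.
have Vle : Vk n <= (V d j.+1)%:R * D%:R ^+ D.
  rewrite -natrX -natrM ler_nat; apply: leq_trans (V_le hD _ _).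
  have kj : (k.+1 <= j.+1 + D)%N by rewrite /j; lia.
  rewrite -/k -(subnKC kj) /V [X in (_ <= X)%N](big_cat_nat _ (n := k.+1)) ?leq_addr //=.
  by rewrite leq_pmulr // prodn_gt0 // => i; apply: leq_trans (hd2 i).
apply: le_trans (entropy_ge hd2 invIE I_gt0 j n hF).
rewrite -/ev -!mulrA ler_pM2l //; apply: le_trans ev_ge.
rewrite mulrC [_^-1 * Vk n]mulrC ler_pM2r; last lra.
by rewrite ler_pdivrMr.
Qed.

(** Saturation at the letter 1 makes a fibre of H over the symmetric group nonempty, so the order of
    this group is at most |H|. The alphabet is thus bounded independently of the level. *)
Lemma card_letter_le j : (#|@letter d F I j| <= #|I| * #|F| + #|I|)%N.
Proof.
rewrite card_sum card_prod leq_add2l.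
have t1 : (1 < d j)%N := hd2 j.
have := @hc_unif j (Ordinal t1) (isT : 0 < 1)%N 1%g.
by case: #|[set i | _]| => [|m] e; [move: I_gt0; rewrite -e | rewrite -e leq_pmull].
Qed.

Lemma upper_le (N l lD l2 lM LN M' Q : R) :
  1 <= N -> 1 <= l -> 0 <= lD -> 0 <= l2 -> 0 <= lM -> 0 <= Q -> Q <= N ->
  LN <= l2 + (2 * l + 1) * lD -> M' <= lM ->
  N * LN + M' * (2 * N + 2 * Q) <= (1 + l2 + 3 * lD + 4 * lM) * (N * l).
Proof.
move=> N1 l1 lD0 l20 lM0 Q0 QN hL hM.
have h1 : N * LN <= N * (l2 + (2 * l + 1) * lD) by apply: ler_wpM2l => //; lra.
have h2 : M' * (2 * N + 2 * Q) <= lM * (4 * N).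
  apply: le_trans (_ : lM * (2 * N + 2 * Q) <= _).
    by apply: ler_wpM2r => //; lra.
  by apply: ler_wpM2l => //; lra.
apply: le_trans (lerD h1 h2) _.
have -> : N * (l2 + (2 * l + 1) * lD) + lM * (4 * N) =
  N * (l2 + (2 * l + 1) * lD + 4 * lM) by ring.
rewrite mulrCA; apply: ler_wpM2l; first lra.
have := ler_wpM2l l20 l1; have := ler_wpM2l lD0 l1; have := ler_wpM2l lM0 l1; lra.
Qed.

Lemma entropy_upper : exists2 C : R, 0 < C &
  forall n, (0 < n)%N -> 1 <= ln n%:R -> entropy F hc n <= C * (Vk n * ln n%:R).
Proof.
have D2 : (2 <= D)%N by apply: leq_trans (hd2 0) (hD 0).
have D0 : 0 < D%:R :> R by rewrite ltr0n (leq_trans _ D2).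
pose M : R := 2 * (#|I| * #|F| + #|I|)%N%:R.
have M2 : 1 <= M.
  have : 1 <= (#|I| * #|F| + #|I|)%N%:R :> R by rewrite ler1n addn_gt0 I_gt0 orbT.
  by rewrite /M; lra.
have ln_ge0 (x : R) : 1 <= x -> 0 <= ln x.
  by move=> x1; rewrite -[0](ln_1 : ln 1 = 0); apply: ler_ln; rewrite ?ltr01.
have lM := ln_ge0 _ M2.
have lD : 0 <= ln D%:R by apply: ln_ge0; rewrite ler1n (leq_trans _ D2).
have l2 : 0 <= ln 2 by apply: ln_ge0; lra.
exists (1 + ln 2 + 3 * ln D%:R + 4 * ln M); first lra.
move=> n n0 ln1; have N1 := Vk_ge1 n; set k := kfun d n in N1 *.
apply: le_trans (entropy_le hd2 F mulIE I_gt0 hc_unif k n) _.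
set N := (V d k.+1)%:R in N1 *.
(* Since n <= W_(k+1) = V_(k+1) / q_(k+1), level k + 1 balances the two terms of [entropy_le]. *)
have qn : q R d k.+1 * n%:R <= N.
  have [h _] := kfunP hd2 n0; rewrite -/k in h.
  have := ler_wpM2l (ltW (q_gt0 R hd2 k.+1)) h; rewrite /W -/N mulrCA mulfV ?mulr1 //.
  by rewrite lt0r_neq0 // q_gt0.
have lnM' : ln (2 * #|@letter d F I k|%:R) <= ln M.
  apply: ler_ln; last by rewrite ler_wpM2l // ler_nat card_letter_le.
  by rewrite mulr_gt0 // ltr0n card_sum addn_gt0 card_perm_gt0 orbT.
have lnN : ln (2 * N) <= ln 2 + (2 * ln n%:R + 1) * ln D%:R.
  rewrite lnM //; last lra.
  rewrite lerD2l; apply: le_trans (_ : ln (D%:R ^+ k.+1) <= _).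
    apply: ler_ln; first lra.
    rewrite -natrX ler_nat; have := V_le hD 0 k.+1.
    by rewrite (_ : V d 0 = 1%N) ?mul1n // /V big_geq.
  rewrite ln_expr // -natr1; apply: ler_wpM2r => //; rewrite lerD2r.
  exact: kfun_ln.
apply: upper_le => //.
by apply: mulr_ge0; rewrite ?ler0n // ltW // q_gt0.
Qed.

End Main.

(* A ratio to the target of order between a constant and ln n disappears
   in the exponent, since ln ln n = o(ln n). *)
Lemma exponent_close (c C eps : R) : 0 < c -> 0 < C -> 0 < eps -> exists B : R,
  forall l v h : R, B <= l -> 1 <= l -> 1 <= v -> c * v <= h -> h <= C * (v * l) ->
  `|ln h / l - ln v / l| <= eps.
Proof.
move=> c0 C0 e0; have e2 : 0 < eps / 2 by lra.
pose K := `|ln c| + `|ln C| + `|ln (eps / 2)|.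
(* Beyond this bound the constants collected in [K] cost at most (eps / 2) l; the other half of eps
   absorbs ln l. *)
exists (K * (2 / eps)) => l v h lB l1 v1 h1 h2.
have l0 : 0 < l by lra.
have v0 : 0 < v by lra.
have h0 : 0 < h by apply: lt_le_trans h1; apply: mulr_gt0.
have a1 := ler_ln (mulr_gt0 c0 v0) h1; rewrite lnM // in a1.
have a2 := ler_ln h0 h2; rewrite !lnM ?mulr_gt0 // in a2.
have a3 := ln_div_le e2 l0.
have Kl : K <= eps / 2 * l.
  have : K * (2 / eps) * (eps / 2) <= l * (eps / 2) by apply: ler_wpM2r => //; lra.
  have -> : K * (2 / eps) * (eps / 2) = K by field; lra.
  lra.
have b1 := ler_norm (- ln c); have b2 := ler_norm (ln C).
have b3 := ler_norm (- ln (eps / 2)); rewrite normrN in b1; rewrite normrN in b3.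
have n1 := normr_ge0 (ln c); have n2 := normr_ge0 (ln C).
have n3 := normr_ge0 (ln (eps / 2)).
have el : 0 < eps / 2 * l by apply: mulr_gt0.
rewrite -mulrBl normrM [`|l^-1|]gtr0_norm ?invr_gt0 // ler_pdivrMr // ler_norml.
by apply/andP; split; move: Kl; rewrite /K; lra.
Qed.

Local Close Scope ring_scope.
Unset Implicit Arguments.

Theorem mainTheorem10
  (d : nat -> nat) (hd2 : forall j, 2 <= d j) (hdb : exists D, forall j, d j <= D)
  (F : finGroupType) (hF : 1 < #|[set: F]|)
  (I : finType) (hc : I -> Hcoord d)
  (hc_dummy : forall i l (t : 'I_(d l)), nat_of_ord t = 0 -> hc i l t = 1%g)
  (hc_inj : forall i j, (forall l t, hc i l t = hc j l t) -> i = j)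
  (hc_one : exists i, forall l t, hc i l t = 1%g)
  (hc_mul : forall i j, exists k, forall l t, hc k l t = (hc i l t * hc j l t)%g)
  (hc_inv : forall i, exists j, forall l t, hc j l t = ((hc i l t)^-1)%g)
  (hc_unif : forall l (t : 'I_(d l)), 0 < nat_of_ord t ->
      forall p : {perm 'I_(d l.+1)},
        #|[set i | hc i l t == p]| * #|{perm 'I_(d l.+1)}| = #|I|) :
  forall eps : R, Rlt R0 eps ->
    exists N0 : nat, forall n : nat, N0 <= n ->
      Rle (Rabs (Rminus (Rdiv (ln (@entropy d I F hc n)) (ln (INR n))) (beta d n))) eps.
Proof.
move=> eps /RltP eps0.
have [D hD] := hdb.
have I_gt0 : 0 < #|I| by have [i _] := hc_one; apply/card_gt0P; exists i.
have [mulI mulIE] := fin_all_exists (fun p : I * I => hc_mul p.1 p.2).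
have [invI invIE] := fin_all_exists hc_inv.
have mE i j l t : hc (mulI (i, j)) l t = (hc i l t * hc j l t)%g by apply: (mulIE (i, j)).
rewrite cardsT in hF.
have [c c0 lower] := entropy_lower hd2 hD invIE I_gt0 hc_unif hF.
have [C C0 upper] := entropy_upper hd2 hD F (mulI := fun i j => mulI (i, j)) mE I_gt0 hc_unif.
have [B close] := exponent_close c0 C0 eps0.
(* From [m] on, ln n is at least both [B] and 1. *)
have [m /RltP hm] := INR_unbounded (exp (Rmax B R1)).
exists (maxn m (4 * D)) => n; rewrite geq_max => /andP[mn Dn].
have lnB : (Num.max B 1 <= ln n%:R)%R.
  rewrite -[leLHS]ln_exp; apply: ler_ln; first exact: exp_gt0.
  rewrite -RmaxE; apply: ltW; apply: lt_le_trans hm _.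
  by rewrite INRE ler_nat.
move: lnB; rewrite ge_max => /andP[lB l1].
have n0 : 0 < n.
  by apply: leq_trans Dn; rewrite muln_gt0 /=; apply: leq_trans (hD 0); apply: ltnW.
have := close _ _ _ lB l1 (Vk_ge1 hd2 n) (lower n Dn) (upper n n0 l1).
by move=> h; apply/RleP; rewrite RabsE RminusE RdivE INRE /beta RdivE !INRE.
Qed.
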